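(* Assume that $H$ and $(c_{ij})$ satisfy (A1)–(A4) listed in the context. Let $v_1,v_2:\mathbb{T}^d\times I\to\mathbb{R}$ be Lipschitz continuous viscosity solutions of the system $$H(x,Dv(x,i),i)+\sum_{j=1}^m c_{ij}\,(v(x,i)-v(x,j))=0\quad\text{in }\mathbb{T}^d\times I .$$ If $$\int_{\mathbb{T}^d\times\mathbb{R}^d\times I} v_1(x,i)\,d\mu(x,q,i)\le \int_{\mathbb{T}^d\times\mathbb{R}^d\times I} v_2(x,i)\,d\mu(x,q,i)$$ for every generalized Mather measure $\mu\in\tilde{\mathcal M}$, then $v_1(x,i)\le v_2(x,i)$ for all $(x,i)\in\mathbb{T}^d\times I$.
   Context: $\mathbb{T}^d$ is the $d$-dimensional flat torus, $m\in\mathbb{N}$ is fixed and $I=\{1,\dots,m\}$. The $c_{ij}\ge 0$ ($i,j\in I$) are given constants, and $H:\mathbb{T}^d\times\mathbb{R}^d\times I\to\mathbb{R}$ is such that $H(\cdot,\cdot,i)\in C^2(\mathbb{T}^d\times\mathbb{R}^d)$ for all $i\in I$. Assumptions: (A1) for every $x\in\mathbb{T}^d$ and $i\in I$, $p\mapsto H(x,p,i)$ is convex; (A2) uniformly for $x\in\mathbb{T}^d$ and $i\in I$, $\lim_{|p|\to\infty}H(x,p,i)/|p|=\infty$ and $\lim_{|p|\to\infty}\left(\frac{1}{2d}H(x,p,i)^2+D_xH(x,p,i)\cdot p\right)=\infty$; (A3) there is $C>0$ with $|D_xH(x,p,i)|\le C(1+|p|^2)$ for all $(x,p,i)\in \mathbb{T}^d\times\mathbb{R}^d\times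 I$; (A4) $c_{ij}=c_{ji}$ for all $i,j\in I$. Viscosity solutions of the system: a function $v$ with each $v(\cdot,i)$ continuous is a viscosity subsolution (resp. supersolution) if for each $i\in I$ and each $\varphi\in C^1(\mathbb{T}^d)$ such that $v(\cdot,i)-\varphi$ has a maximum (resp. minimum) at $x$, one has $H(x,D\varphi(x),i)+\sum_j c_{ij}(v(x,i)-v(x,j))\le 0$ (resp. $\ge 0$); a solution is both. For $\phi:\mathbb{T}^d\times I\to\mathbb{R}$ set $\Theta\phi(x,i)=\sum_{j=1}^m c_{ij}(\phi(x,i)-\phi(x,j))$. Set $L(x,q,i)=\sup_{p\in\mathbb{R}^d}\{p\cdot q-H(x,p,i)\}$. Let $\mathcal{F}$ be the set of Radon probability measures $\mu$ on $\mathbb{T}^d\times\mathbb{R}^d\times I$ such that $$\int_{\mathbb{T}^d\times\mathbb{R}^d\times I} \big(q\cdot D\phi(x,i)+\Theta\phi(x,i)\big)\,d\mu(x,q,i)=0$$ (the integrand being integrable) for all $\phi$ with $\phi(\cdot,i)\in C^1(\mathbb{T}^d)$ for every $i\in I$. A generalized Mather measure is a minimizer of $\inf_{\mu\in\mathcal{F}}\int L(x,q,i)\,d\mu(x,q,i)$; $\tilde{\mathcal M}$ denotes the set of all generalized Mather measures. *)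

(* Defs.v *)
From HB Require Import structures.
From mathcomp Require Import all_boot all_order all_algebra.
From mathcomp Require Import generic_quotient.
From mathcomp Require Import all_classical all_reals all_analysis.

Set Implicit Arguments.
Unset Strict Implicit.
Unset Printing Implicit Defensive.

Import Order.TTheory GRing.Theory Num.Theory.
Import numFieldNormedType.Exports.

Local Open Scope classical_set_scope.
Local Open Scope quotient_scope.
Local Open Scope ring_scope.

Section euclidean.
Context {R : realType} {d : nat}.

Definition dot (p q : 'rV[R]_d) : R := \sum_k p 0 k * q 0 k.

(* The library norm [`|p|] on row vectors is the sup norm. *)
Definition enorm (p : 'rV[R]_d) : R := Num.sqrt (dot p p).

Definition gradient (f : 'rV[R]_d -> R) (x : 'rV[R]_d) : 'rV[R]_d :=
  \row_k 'D_(delta_mx 0 k) f x.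

(* [F x p i --> +oo] as [|p| --> oo], uniformly in [x] and [i]. *)
Definition unif_coercive (X I : Type) (F : X -> 'rV[R]_d -> I -> R) : Prop :=
  forall M : R, exists K : R, forall x p i, K <= enorm p -> M <= F x p i.

End euclidean.

(* [C1] and [C2] are meant for finite-dimensional [V]: there, continuity of all
   the directional derivatives is continuity of the differential. *)
Definition C1 {R : realType} {V : normedModType R} (f : V -> R) : Prop :=
  (forall x, differentiable f x) /\ (forall h, continuous ('D_h f)).

Definition C2 {R : realType} {V : normedModType R} (f : V -> R) : Prop :=
  C1 f /\ (forall h, C1 ('D_h f)).

Section torus_def.
Context (R : realType) (d : nat).

Definition lattice_rel (x y : 'rV[R]_d) : bool :=
  [forall k, x 0 k - y 0 k \is a Num.int].

Lemma lattice_rel_equiv : equiv_class_of lattice_rel.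
Proof.
split.
- by move=> x; apply/forallP => k; rewrite subrr rpred0.
- by move=> x y; apply/eq_forallb => k; rewrite -opprB rpredN.
- move=> y x z /forallP xy /forallP yz; apply/forallP => k.
  by rewrite -(subrKA (y 0 k)) rpredD.
Qed.

Canonical lattice_equiv := EquivRelPack lattice_rel_equiv.

(* The flat torus [R^d / Z^d], with the quotient topology. *)
Definition torus : Type := quotient_topology {eq_quot lattice_equiv}.

HB.instance Definition _ := PointedTopological.on torus.
HB.instance Definition _ := Quotient.on torus.

End torus_def.

(* A finite nonempty set of [n.+1] indices, with the discrete topology. *)
Definition idx (n : nat) : Type := discrete_topology 'I_n.+1.

HB.instance Definition _ (n : nat) := Finite.copy (idx n) 'I_n.+1.
HB.instance Definition _ (n : nat) := isPointed.Build (idx n) ord0.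
HB.instance Definition _ (n : nat) :=
  DiscreteTopology.copy (idx n) (discrete_topology 'I_n.+1).

Section torus_calculus.
Context {R : realType} {d : nat}.

Definition torus_pi (x : 'rV[R]_d) : torus R d := \pi_(torus R d) x.

(* The flat distance: the infimum of [|x - y|] over all the representatives. *)
Definition torus_dist (a b : torus R d) : R :=
  inf [set r | exists x y, [/\ torus_pi x = a, torus_pi y = b & r = enorm (x - y)]].

Definition torus_lipschitz (u : torus R d -> R) : Prop :=
  exists C : R, forall a b, `|u a - u b| <= C * torus_dist a b.

Definition torus_C1 (u : torus R d -> R) : Prop := C1 (u \o torus_pi).

(* [u \o torus_pi] is periodic, so its gradient does not depend on the choice of the
   representative. *)
Definition torus_grad (u : torus R d -> R) (a : torus R d) : 'rV[R]_d :=
  gradient (u \o torus_pi) (repr a).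

End torus_calculus.

Section hamilton_jacobi.
Context {R : realType} {d n : nat}.

Implicit Types (H : torus R d -> 'rV[R]_d -> idx n -> R)
  (c : idx n -> idx n -> R) (u v phi : torus R d -> idx n -> R).

Definition hamiltonian_C2 H : Prop :=
  forall i, C2 (fun z : 'rV[R]_d * 'rV[R]_d => H (torus_pi z.1) z.2 i).

Definition DxH H (x : torus R d) (p : 'rV[R]_d) (i : idx n) : 'rV[R]_d :=
  torus_grad (fun y => H y p i) x.

Definition coupling c phi (x : torus R d) (i : idx n) : R :=
  \sum_(j : idx n) c i j * (phi x i - phi x j).

Definition viscosity_subsolution H c v : Prop :=
  (forall i, continuous (v ^~ i)) /\
  forall i (phi : torus R d -> R) x, torus_C1 phi ->
    (forall y, v y i - phi y <= v x i - phi x) ->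
    H x (torus_grad phi x) i + coupling c v x i <= 0.

Definition viscosity_supersolution H c v : Prop :=
  (forall i, continuous (v ^~ i)) /\
  forall i (phi : torus R d -> R) x, torus_C1 phi ->
    (forall y, v x i - phi x <= v y i - phi y) ->
    0 <= H x (torus_grad phi x) i + coupling c v x i.

Definition viscosity_solution H c v : Prop :=
  viscosity_subsolution H c v /\ viscosity_supersolution H c v.

Definition lagrangian H (x : torus R d) (q : 'rV[R]_d) (i : idx n) : \bar R :=
  ereal_sup [set (dot p q - H x p i)%:E | p in [set: 'rV[R]_d]].

End hamilton_jacobi.

Section mather_measures.
Context {R : realType} {d n : nat}.

Notation phase := (torus R d * 'rV[R]_d * idx n)%type.

Definition borel_phase := g_sigma_algebraType (@open phase).

Implicit Types mu : probability borel_phase R.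

Definition radon mu : Prop :=
  forall A : set borel_phase, measurable A ->
    mu A = ereal_sup [set mu K | K in [set K : set phase |
                                        compact K /\ K `<=` A]].

Definition closed_measure (c : idx n -> idx n -> R) mu : Prop :=
  radon mu /\
  forall phi : torus R d -> idx n -> R, (forall i, torus_C1 (phi ^~ i)) ->
    let g (z : borel_phase) : \bar R :=
      (dot z.1.2 (torus_grad (phi ^~ z.2) z.1.1)
       + coupling c phi z.1.1 z.2)%:E in
    mu.-integrable setT g /\ (\int[mu]_z g z = 0)%E.

Definition mather_action (H : torus R d -> 'rV[R]_d -> idx n -> R) mu : \bar R :=
  (\int[mu]_z lagrangian H z.1.1 z.1.2 z.2)%E.

Definition mather_measure (H : torus R d -> 'rV[R]_d -> idx n -> R)
    (c : idx n -> idx n -> R) mu : Prop :=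
  closed_measure c mu /\
  forall nu, closed_measure c nu -> (mather_action H mu <= mather_action H nu)%E.

End mather_measures.
Arguments borel_phase : clear implicits.

(* Main.v *)
(** The idea is to use duality instead of the nonlinear adjoint method. Suppose
    that [v1 > v2] somewhere, let [w := v1 - v2] and [0 < s < max w]. A closed
    measure [mu] with [int L dmu <= 0] and [int w dmu >= s] exists unless, by the
    Hahn-Banach theorem, there are a [C^1] function [psi] and [l >= 0] with
    [H (x, D psi, i) + Theta psi < l * (s - w)] (after a normalization, and with
    [H] replaced by the supremum of its tangents at the momenta [|p| <= K], where
    [K] is a Lipschitz constant of [v2]; this keeps the measures on a compact
    set). Mix [psi], with a small weight, with a [C^1] approximate subsolution
    [phi] close to [v1]: at a minimum point of the difference of [v2] and the
    mixture, [w] is close to its maximum, hence [w > s], and the supersolution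
    property of [v2] is violated. So [mu] exists. The same [C^1] approximate
    subsolutions show that every closed measure has nonnegative action; hence
    [mu] is a Mather measure, and [int w dmu >= s > 0].

    The approximations [phi] of [v1] are Lasry-Lions regularizations. The
    sup-convolution of a subsolution is touched from below at each point by a
    paraboloid whose slope almost satisfies [H <= - Theta v1]; by convexity of [H]
    this survives the subsequent inf-convolution, which makes it [C^{1,1}].

    To turn the positive functional given by Hahn-Banach into a measure, the
    compact set is parametrised by a space-filling curve, and the functional is
    represented on the line by the quantile function of its distribution: [mu] is
    then the image of the Lebesgue measure of [[0, 1]]. *)

Require Import Defs.
From HB Require Import structures.
From mathcomp Require Import all_boot all_order all_algebra.
From mathcomp Require Import generic_quotient.
From mathcomp Require Import all_classical all_reals all_analysis.
From mathcomp Require Import measurable_realfun.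
From mathcomp Require Import zify ring lra.

Set Implicit Arguments.
Unset Strict Implicit.
Unset Printing Implicit Defensive.

Import Order.TTheory GRing.Theory Num.Theory.
Import numFieldNormedType.Exports.

Local Open Scope classical_set_scope.
Local Open Scope ring_scope.

(** * Positive functionals and Lebesgue measure *)

Section positive_functional.
Context {R : realType} {T : Type} (E : set T).
Hypothesis E0 : E !=set0.

Implicit Types (f g h : T -> R) (N C : set (T -> R)).

Definition bounded_on f := exists M, forall t, E t -> `|f t| <= M.

(** Negativity with a uniform margin: these functions form the interior of the negative cone in the
    sup norm, the open convex set that is to be separated from [N]. *)
Definition strictly_negative f :=
  exists2 e, 0 < e & forall t, E t -> f t <= - e.

Definition nonneg_cone N :=
  [/\ forall f, N f -> bounded_on f,
      forall f g, N f -> N g -> N (fun t => f t + g t),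
      forall a f, 0 <= a -> N f -> N (fun t => a * f t) &
      forall f, N f -> ~ strictly_negative f].

Lemma bounded_onD f g :
  bounded_on f -> bounded_on g -> bounded_on (fun t => f t + g t).
Proof.
move=> [M fM] [K gK]; exists (M + K) => t Et.
by rewrite (le_trans (ler_normD _ _))// lerD ?fM ?gK.
Qed.

Lemma bounded_onZ a f : bounded_on f -> bounded_on (fun t => a * f t).
Proof.
move=> [M fM]; exists (`|a| * M) => t Et.
by rewrite normrM ler_wpM2l// fM.
Qed.

Lemma bounded_on_cst a : bounded_on (fun=> a).
Proof. by exists `|a|. Qed.

(** Zorn's lemma: each condition on a cone involves at most two functions, and two elements of the
    union of a chain already lie in one of its members. *)
Lemma maximal_nonneg_cone N : nonneg_cone N ->
  exists C, [/\ nonneg_cone C, N `<=` C &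
    forall C', nonneg_cone C' -> C `<=` C' -> C' `<=` C].
Proof.
move=> coneN.
pose S := {C | nonneg_cone C /\ N `<=` C}.
pose r (A B : S) : bool := `[< sval A `<=` sval B >].
have N_S : nonneg_cone N /\ N `<=` N by split.
have [||A totA|[C [coneC NC]] maxC] := @ZL_preorder S (exist _ N N_S) r.
- by move=> A; apply/asboolP.
- by move=> A B D /asboolP AB /asboolP BD; apply/asboolP => f /AB /BD.
- have [[A0 AA0]|A0] := pselect (A !=set0); last first.
    by exists (exist _ N N_S) => B AB; exfalso; apply: A0; exists B.
  pose U : set (T -> R) := [set f | exists2 B, A B & sval B f].
  have common f g : U f -> U g -> exists B, [/\ A B, sval B f & sval B g].
    move=> [B AB Bf] [B' AB' Bg].
    have [/asboolP BB'|/asboolP B'B] := totA _ _ AB AB'.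
    - by exists B'; split => //; exact: BB'.
    - by exists B; split => //; exact: B'B.
  have coneU : nonneg_cone U.
    split=> [f [B _ Bf]|f g Uf Ug|a f a0 [B AB Bf]|f [B _ Bf]].
    - by case: (svalP B) => -[+ _ _ _] _; exact.
    - have [B [AB Bf Bg]] := common _ _ Uf Ug.
      by exists B => //; case: (svalP B) => -[_ + _ _] _; exact.
    - by exists B => //; case: (svalP B) => -[_ _ + _] _; exact.
    - by case: (svalP B) => -[_ _ _ +] _; exact.
  have NU : N `<=` U.
    by move=> f Nf; exists A0 => //; case: (svalP A0) => _; exact.
  by exists (exist _ U (conj coneU NU)) => B AB; apply/asboolP => f Bf; exists B.
- exists C; split=> // C' coneC' CC'.
  pose C's : S := exist _ C' (conj coneC' (subset_trans NC CC')).
  by apply/(asboolP (sval C's `<=` C))/maxC/asboolP.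
Qed.

(** Hahn-Banach separation through cones: a maximal cone [C] contains [f] or [- f] for every bounded
    [f], so it acts as a half-space. The third clause encodes positivity and normalization of [L] at
    once. *)
Lemma nonneg_functional N : nonneg_cone N ->
  exists L : (T -> R) -> R,
    [/\ forall f g, bounded_on f -> bounded_on g ->
          L (fun t => f t + g t) = L f + L g,
        forall a f, bounded_on f -> L (fun t => a * f t) = a * L f,
        forall f c, bounded_on f -> (forall t, E t -> f t <= c) -> L f <= c &
        forall f, N f -> 0 <= L f].
Proof.
move=> /[dup] -[Nbnd _ _ _] /maximal_nonneg_cone[C [[bndC addC scaleC posC] NC maxC]].
have [t0 Et0] := E0.
(* By maximality, [f] belongs to [C] as soon as the cone spanned by [C] and [f] has no strictly
   negative element. Nonemptiness of [C] serves to exhibit [f] itself as [0 * c0 + 1 * f]. *)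
have C_0 f : bounded_on f -> (forall c a, C c -> 0 <= a ->
    ~ strictly_negative (fun t => c t + a * f t)) -> C !=set0 -> C f.
  move=> bf Cf [c0 Cc0].
  apply: (maxC [set g | exists c a, [/\ C c, 0 <= a &
      g = fun t => c t + a * f t]]).
  - split.
    + by move=> _ [c [a [/bndC bc a0 ->]]]; apply/bounded_onD/bounded_onZ.
    + move=> _ _ [c [a [Cc a0 ->]]] [c' [a' [Cc' a'0 ->]]].
      exists (fun t => c t + c' t), (a + a'); split; [exact: addC|exact: addr_ge0|].
      by apply/funext => t; ring.
    + move=> b _ b0 [c [a [Cc a0 ->]]].
      exists (fun t => b * c t), (b * a); split; [exact: scaleC|exact: mulr_ge0|].
      by apply/funext => t; ring.
    + by move=> _ [c [a [Cc a0 ->]]]; exact: Cf.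
  - move=> c Cc; exists c, 0; split => //.
    by apply/funext => t; rewrite mul0r addr0.
  - exists (fun t => 0 * c0 t), 1; split => //; first exact: scaleC.
    by apply/funext => t; ring.
have C0 : C !=set0.
  apply: contrapT => C0.
  have C'0 : nonneg_cone [set (fun=> 0) : T -> R].
    split.
    - by move=> _ ->; exact: bounded_on_cst.
    - by move=> _ _ -> ->; apply/funext => t; rewrite addr0.
    - by move=> a _ _ ->; apply/funext => t; rewrite mulr0.
    - by move=> _ -> [e e0 /(_ _ Et0)]; rewrite oppr_ge0 leNgt e0.
  apply: (C0); exists (fun=> 0); apply: (maxC _ C'0) => // c Cc.
  by exfalso; apply: C0; exists c.
have Cge0 f : bounded_on f -> (forall t, E t -> 0 <= f t) -> C f.
  move=> bf f0; apply: C_0 => // c a Cc a0 [e e0 caf].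
  apply: (posC _ Cc); exists e => // t Et.
  by rewrite (le_trans _ (caf t Et))// lerDl mulr_ge0// f0.
(* If [f] is rejected, some [c + a * f] is strictly negative with [a > 0]; then [- f] is [a^-1 * c]
   plus a nonnegative function. *)
have dichotomy f : bounded_on f -> ~ C f -> C (fun t => - f t).
  move=> bf NCf; apply: contrapT => NCNf; apply: NCf; apply: C_0 => // c a Cc a0.
  move=> [e e0 caf].
  have [a_eq0|a_neq0] := eqVneq a 0.
    apply: (posC _ Cc); exists e => // t Et.
    by have := caf t Et; rewrite a_eq0 mul0r addr0.
  have a_gt0 : 0 < a by rewrite lt_def a_neq0.
  apply: NCNf.
  rewrite (_ : (fun t => - f t) =
     (fun t => a^-1 * c t + (- f t - a^-1 * c t))); last first.
    by apply/funext => t; ring.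
  apply: addC; first by apply: scaleC => //; rewrite invr_ge0.
  apply: Cge0.
    rewrite (_ : (fun t => - f t - _) =
      (fun t => (-1) * f t + (- a^-1) * c t)); last by apply/funext => t; ring.
    by apply: bounded_onD; apply: bounded_onZ => //; exact: bndC.
  move=> t Et; have := caf t Et.
  have -> : - f t - a^-1 * c t = a^-1 * (- (c t + a * f t)) by field.
  by move=> ?; rewrite mulr_ge0 ?invr_ge0//; lra.
(* The maximal cone [C] is a half-space, and [L f] is the level at which
   [f - r] leaves it. *)
pose is_val f l := (forall r, r < l -> C (fun t => f t - r)) /\
                   (forall r, l < r -> C (fun t => r - f t)).
(* If [l' < l], then [f - r'] and [r - f] lie in [C] for some [r < r'] in between, and their sum is
   a negative constant. *)
have val_uniq f l l' : is_val f l -> is_val f l' -> l <= l'.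
  move=> [fl _] [_ fl']; rewrite leNgt; apply/negP => l'l.
  pose r := l' + (l - l') / 3; pose r' := l' + 2 * (l - l') / 3.
  have Cr : C (fun t => f t - r') by apply: fl; rewrite /r'; lra.
  have Cr' : C (fun t => r - f t) by apply: fl'; rewrite /r; lra.
  apply: (posC _ (addC _ _ Cr Cr')); exists ((l - l') / 3); first lra.
  by move=> t Et; rewrite /r /r'; lra.
have bndB f r : bounded_on f -> bounded_on (fun t => f t - r).
  by move=> bf; apply: bounded_onD => //; exact: bounded_on_cst.
have val_ex f : bounded_on f -> exists l, is_val f l.
  move=> bf; have [M fM] := bf.
  pose S := [set r | C (fun t => f t - r)].
  have S_lb : S (- M).
    apply: Cge0; first exact: bndB.
    by move=> t /fM; rewrite ler_norml => /andP[]; lra.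
  have S_ub : ubound S M.
    move=> r Sr; rewrite leNgt; apply/negP => Mr.
    apply: (posC _ Sr); exists (r - M); first lra.
    by move=> t /fM; rewrite ler_norml => /andP[]; lra.
  have S_sup : has_sup S by split; [exists (- M)|exists M].
  exists (sup S); split=> r.
    move=> /(sup_gt (ex_intro _ _ S_lb))[r' Sr' rr'].
    rewrite (_ : (fun t => f t - r) = (fun t => (f t - r') + (r' - r))); last first.
      by apply/funext => t; ring.
    apply: addC => //; apply: Cge0; first exact: bounded_on_cst.
    by move=> t _; lra.
  move=> Sr.
  rewrite (_ : (fun t => r - f t) = (fun t => - (f t - r))); last first.
    by apply/funext => t; ring.
  apply: dichotomy; first exact: bndB.
  by move=> /(ub_le_sup (ex_intro _ _ S_ub)); rewrite leNgt Sr.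
(* The default 0 is taken only where no level exists; bounded functions have one. *)
pose L f := xget 0 [set l | is_val f l].
have LE f : bounded_on f -> is_val f (L f).
  by move=> /val_ex[l fl]; exact: (xgetPex 0 (ex_intro _ l fl)).
have L_unique f l : is_val f l -> bounded_on f -> L f = l.
  by move=> fl /LE Lf; apply/eqP; rewrite eq_le (val_uniq _ _ _ Lf fl) (val_uniq _ _ _ fl Lf).
have LD f g : bounded_on f -> bounded_on g ->
    L (fun t => f t + g t) = L f + L g.
  move=> bf bg; apply: L_unique; last exact: bounded_onD.
  have [f1 f2] := LE _ bf; have [g1 g2] := LE _ bg.
  split=> r rfg.
    pose e := (L f + L g - r) / 2.
    rewrite (_ : (fun t => _) =
      (fun t => (f t - (L f - e)) + (g t - (L g - e)))); last first.
      by apply/funext => t; rewrite /e; field.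
    by apply: addC; [apply: f1|apply: g1]; rewrite /e; lra.
  pose e := (r - (L f + L g)) / 2.
  rewrite (_ : (fun t => _) =
    (fun t => ((L f + e) - f t) + ((L g + e) - g t))); last first.
    by apply/funext => t; rewrite /e; field.
  by apply: addC; [apply: f2|apply: g2]; rewrite /e; lra.
have LZ_gt0 a f : 0 < a -> bounded_on f -> L (fun t => a * f t) = a * L f.
  move=> a0 bf; apply: L_unique; last exact: bounded_onZ.
  have [f1 f2] := LE _ bf; split=> r raf.
    rewrite (_ : (fun t => _) = (fun t => a * (f t - r / a))); last first.
      by apply/funext => t; field; rewrite gt_eqF.
    by apply: scaleC; [exact: ltW|apply: f1; rewrite ltr_pdivrMr// mulrC].
  rewrite (_ : (fun t => _) = (fun t => a * (r / a - f t))); last first.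
    by apply/funext => t; field; rewrite gt_eqF.
  by apply: scaleC; [exact: ltW|apply: f2; rewrite ltr_pdivlMr// mulrC].
have LN f : bounded_on f -> L (fun t => - f t) = - L f.
  move=> bf; apply: L_unique.
    have [f1 f2] := LE _ bf; split=> r rf.
      rewrite (_ : (fun t => _) = (fun t => - r - f t)); last first.
        by apply/funext => t; ring.
      by apply: f2; lra.
    rewrite (_ : (fun t => _) = (fun t => f t - (- r))); last first.
      by apply/funext => t; ring.
    by apply: f1; lra.
  by case: bf => M fM; exists M => t /fM; rewrite normrN.
have L0 : L (fun=> 0) = 0.
  apply: L_unique; last exact: bounded_on_cst.
  by split=> r r0; apply: Cge0; (try by move=> t _; lra);
    exact: bounded_on_cst.
exists L; split=> //.
- move=> a f bf; have [a0|a0|->] := ltgtP a 0; last 2 first.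
  + exact: LZ_gt0.
  + by rewrite mul0r -[RHS]L0; congr L; apply/funext => t; rewrite mul0r.
  have -> : (fun t => a * f t) = (fun t => - ((- a) * f t)).
    by apply/funext => t; ring.
  by rewrite LN ?LZ_gt0 ?oppr_gt0//; [ring|exact: bounded_onZ].
- move=> f c bf fc; rewrite leNgt; apply/negP => cL.
  have [f1 _] := LE _ bf.
  have Cf : C (fun t => f t - (c + L f) / 2) by apply: f1; lra.
  apply: (posC _ Cf); exists ((L f - c) / 2); first lra.
  by move=> t /fc; lra.
- move=> f Nf; rewrite leNgt; apply/negP => L_lt0.
  have [_ f2] := LE _ (Nbnd _ Nf).
  have Cf : C (fun t => L f / 2 - f t) by apply: f2; lra.
  apply: (posC _ (addC _ _ Cf (NC _ Nf))); exists (- (L f) / 2); first lra.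
  by move=> t _; lra.
Qed.

End positive_functional.

(** * Positive functionals on a compact set of reals, and quantile functions *)

Section quantile_representation.
Context {R : realType} (E : set R).
Hypotheses (E0 : E !=set0) (cE : compact E).

Lemma compact_max (t : R) : E `&` [set s | s <= t] !=set0 ->
  exists s, [/\ E s, s <= t & forall r, E r -> r <= t -> r <= s].
Proof.
move=> Et0; have cEt : compact (E `&` [set s | s <= t]).
  apply: compact_closedI => //; exact: closed_le.
have [] := @compact_EVT_max _ R id _ Et0 cEt.
  by apply: continuous_subspaceT => x; exact: cvg_id.
move=> s /[!inE]/= -[Es st] smax; exists s; split=> // r Er rt.
by apply: smax; rewrite inE.
Qed.

Lemma compact_inf_mem (A : set R) : A !=set0 -> A `<=` E -> E (inf A).
Proof.
move=> A0 AE; have [M [_ EM]] := compact_bounded cE.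
have hA : has_inf A.
  split=> //; exists (- (M + 1)) => x /AE /EM/= /(_ (M + 1)).
  by rewrite ltrDl ltr01 ler_norml => /(_ isT)/andP[].
have clE : closed E by apply: compact_closed => //; exact: Rhausdorff.
apply: clE => B /nbhs_ballP[e /= e0 eB].
have [x Ax xe] := inf_adherent e0 hA.
exists x; split; first exact: AE.
apply: eB; rewrite /ball/= ltr_distlC.
by rewrite xe andbT (lt_le_trans _ (ge_inf hA.2 Ax))// ltrBlDr ltrDl.
Qed.

Variable L : (R -> R) -> R.
Hypotheses
  (LD : forall f g, bounded_on E f -> bounded_on E g ->
     L (fun t => f t + g t) = L f + L g)
  (LZ : forall a f, bounded_on E f -> L (fun t => a * f t) = a * L f)
  (L_le : forall f c, bounded_on E f -> (forall t, E t -> f t <= c) -> L f <= c).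

Lemma functionalB f g : bounded_on E f -> bounded_on E g ->
  L (fun t => f t - g t) = L f - L g.
Proof.
move=> bf bg; rewrite -mulN1r -LZ// -LD//; last exact: bounded_onZ.
by congr L; apply/funext => t; rewrite mulN1r.
Qed.

Lemma functional_ge f c : bounded_on E f -> (forall t, E t -> c <= f t) -> c <= L f.
Proof.
move=> bf cf; rewrite -lerN2 -mulN1r -LZ//.
by apply: L_le; [exact: bounded_onZ|move=> t /cf; lra].
Qed.

Lemma functional_cst c : L (fun=> c) = c.
Proof.
have bc := bounded_on_cst E c.
by apply/eqP; rewrite eq_le L_le//= functional_ge.
Qed.

Lemma functional_mono f g : bounded_on E f -> bounded_on E g ->
  (forall t, E t -> f t <= g t) -> L f <= L g.
Proof.
move=> bf bg fg; rewrite -subr_ge0 -functionalB//.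
apply: functional_ge; last by move=> t /fg; rewrite subr_ge0.
apply: bounded_onD => //; case: bf => M fM; exists M => t /fM.
by rewrite normrN.
Qed.

Lemma functional_eq f g : bounded_on E f -> bounded_on E g ->
  (forall t, E t -> f t = g t) -> L f = L g.
Proof.
move=> bf bg fg; apply/eqP; rewrite eq_le.
by rewrite !functional_mono// => t /fg ->.
Qed.

Let step (t s : R) : R := (s <= t)%R%:R.

Let bstep t : bounded_on E (step t).
Proof. by exists 1 => s _; rewrite /step; case: (s <= t); rewrite ?normr1 ?normr0. Qed.

Let F t := L (step t).

Let F_nd t t' : t <= t' -> F t <= F t'.
Proof.
move=> tt'; apply: functional_mono => // s _; rewrite /step ler_nat.
by case: (leP s t) => //= /le_trans ->.
Qed.

(** The generalized inverse of the distribution function [F]. Capping [u] at 1 keeps the set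
    nonempty for every real [u], so the function is monotone on the whole line. As [L] is only
    finitely additive, [F] need not be right-continuous, and the infimum need not be attained. *)
Definition quantile (u : R) := inf [set t | E t /\ Num.min u 1 <= F t].

Let below_quantile_ne u : [set t | E t /\ Num.min u 1 <= F t] !=set0.
Proof.
have [M [_ EM]] := compact_bounded cE.
have EM1 t : E t -> t <= M + 1.
  by move=> /EM/= /(_ (M + 1)); rewrite ltrDl ltr01 => /(_ isT) /(le_trans (ler_norm _)).
have [t [Et _ tmax]] : exists t, [/\ E t, t <= M + 1 &
    forall r, E r -> r <= M + 1 -> r <= t].
  by apply: compact_max; case: E0 => t Et; exists t; split => //; exact: EM1.
exists t; split=> //; suff -> : F t = 1 by rewrite ge_min lexx orbT.
rewrite -[RHS]functional_cst; apply: functional_eq => //.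
  exact: bounded_on_cst.
by move=> s Es; rewrite /step tmax// EM1.
Qed.

Lemma quantile_mem u : E (quantile u).
Proof. by apply: compact_inf_mem => // t []. Qed.

Let below_quantile_lb u : has_lbound [set t | E t /\ Num.min u 1 <= F t].
Proof.
have [M [_ EM]] := compact_bounded cE.
exists (- (M + 1)) => t [/EM/= /(_ (M + 1))].
by rewrite ltrDl ltr01 ler_norml => /(_ isT)/andP[].
Qed.

Lemma quantile_nondecreasing : nondecreasing_fun quantile.
Proof.
move=> u v uv; apply: lb_le_inf => // t [Et tv]; apply: ge_inf => //; split=> //.
by rewrite (le_trans _ tv)// le_min2.
Qed.

Lemma measurable_quantile : measurable_fun setT quantile.
Proof. exact: measurable_realfun.nondecreasing_measurable quantile_nondecreasing. Qed.

(** The infimum ranges over points of [E], so the upper bound uses the largest point of [E] below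
    [t'], where [F] is at least [F t']. *)
Let quantile_between t t' u : u <= 1 -> F t < u -> u <= F t' ->
  t <= quantile u <= t'.
Proof.
move=> u1 Ftu uFt'; apply/andP; split.
  apply: lb_le_inf => // s [Es]; rewrite min_l// => uFs.
  rewrite leNgt; apply/negP => /ltW/F_nd Fst.
  by have := lt_le_trans Ftu (le_trans uFs Fst); rewrite ltxx.
have [s [Es st' smax]] : exists s, [/\ E s, s <= t' &
    forall r, E r -> r <= t' -> r <= s].
  apply: compact_max; apply: contrapT => Et'.
  have F0 : F t' = 0.
    rewrite -[RHS](functional_cst 0); apply: functional_eq => //.
      exact: bounded_on_cst.
    move=> s Es; rewrite /step; case: (leP s t') => // st'.
    by exfalso; apply: Et'; exists s.
  have : 0 <= F t by apply: functional_ge => // s _; rewrite /step ler0n.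
  by rewrite leNgt => /negP; apply; rewrite (lt_le_trans Ftu)// -F0.
apply: (le_trans _ st'); apply: ge_inf => //; split => //.
rewrite min_l// (le_trans uFt')//; apply: functional_mono => // r Er.
by rewrite /step ler_nat; case: (leP r t') => //= /(smax _ Er) ->.
Qed.

Let mu := @lebesgue_measure R.

(* Both sides are close to the same Riemann-Stieltjes sums with respect to the
   distribution function [F] of [L]. *)
Lemma functional_quantile (h : R -> R) : bounded_on E h ->
  (forall e, 0 < e -> exists2 d, 0 < d &
     forall s t, E s -> E t -> `|s - t| < d -> `|h s - h t| <= e) ->
  measurable_fun setT (h \o quantile) ->
  L h = \int[mu]_(u in `]0, 1]) h (quantile u).
Proof.
move=> bh uch mh; have [M hM] := bh.
have int_h a b : mu.-integrable `]a, b] (EFin \o (h \o quantile)).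
  apply: measurable_bounded_integrable => //.
  - by rewrite /mu /= lebesgue_measure_itv/=; case: ifP => // _; rewrite -EFinB ltry.
  - exact: measurable_funTS.
  - exists M; split; [exact: num_real|move=> K MK u _ /=].
    by rewrite (le_trans (hM _ (quantile_mem _)))// ltW.
have int_c a b (c : R) : mu.-integrable `]a, b] (EFin \o cst c).
  apply: measurable_bounded_integrable => //.
  - by rewrite /mu /= lebesgue_measure_itv/=; case: ifP => // _; rewrite -EFinB ltry.
  - exists `|c|; split; [exact: num_real|move=> K MK u _ /=; exact: ltW].
have mass a b : a <= b -> fine (mu `]a, b]) = b - a.
  rewrite le_eqVlt => /predU1P[->|ab].
    by rewrite /mu /= lebesgue_measure_itv/= ltxx subrr.
  by rewrite /mu /= lebesgue_measure_itv/= lte_fin ab.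
pose I x := \int[mu]_(u in `]0, x]) h (quantile u).
pose J t := L (fun s => h s * step t s).
have bhs t : bounded_on E (fun s => h s * step t s).
  exists M => s Es; rewrite /step; case: (s <= t).
    by rewrite mulr1 hM.
  by rewrite mulr0 normr0 (le_trans _ (hM _ Es)).
have F_ge0 t : 0 <= F t by apply: functional_ge => // s _; rewrite /step ler0n.
have F_le1 t : F t <= 1 by apply: L_le => // s _; rewrite /step lern1; case: (s <= t).
(* [I] integrates up to the level [F t], while [J] applies [L] to [h] cut off at [t]. On a short
   interval both increments lie within [e * (F t' - F t)] of the same multiple of [F t' - F t],
   whence the factor 2. *)
have local e d : 0 < e -> (forall s t, E s -> E t -> `|s - t| < d -> `|h s - h t| <= e) ->
    forall t t', t <= t' -> t' - t < d ->
    `|(I (F t') - J t') - (I (F t) - J t)| <= 2 * e * (F t' - F t).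
  move=> e0 hd t t' tt' tt'd.
  have stepE s : 0 <= step t' s - step t s.
    by rewrite subr_ge0 /step ler_nat; case: (leP s t) => //= /le_trans ->.
  have bd : bounded_on E (fun s => step t' s - step t s).
    by exists 1 => s _; rewrite /step; case: (s <= t'); case: (s <= t);
      rewrite ?subrr ?subr0 ?sub0r ?normr0 ?normrN ?normr1.
  have F_E : F t' - F t = L (fun s => step t' s - step t s).
    by rewrite functionalB.
  have J_E : J t' - J t = L (fun s => h s * (step t' s - step t s)).
    by rewrite -functionalB//; congr L; apply/funext => s; ring.
  have I_E : I (F t') - I (F t) = \int[mu]_(u in `]F t, F t']) h (quantile u).
    by rewrite /I -(@Rintegral_itvB _ _ (BRight 0) (BRight (F t')) (F t))//
      bnd_simp ?F_nd.
  have [u0|FF] := ltP (F t) (F t'); last first.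
    have FE : F t' = F t by apply/eqP; rewrite eq_le FF F_nd.
    rewrite FE subrr mulr0 (_ : _ - _ = - (J t' - J t)); last by ring.
    rewrite J_E normrN.
    have : 0 = L (fun s => step t' s - step t s) by rewrite -F_E FE subrr.
    move=> L0.
    have bd' := bounded_onZ M bd.
    rewrite ler_norml; apply/andP; split.
      rewrite oppr0 -[leLHS](mulr0 (- M)) {1}L0 -LZ//.
      apply: functional_mono => //.
        exact: bounded_onZ.
        rewrite (_ : (fun s => _) = (fun s => h s * step t' s + (-1) * (h s * step t s))).
          by apply: bounded_onD => //; exact: bounded_onZ.
        by apply/funext => s; ring.
      move=> s Es; rewrite ler_wpM2r//.
      by have := hM _ Es; rewrite ler_norml => /andP[].
    rewrite -[leRHS](mulr0 M) {1}L0 -LZ//.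
    apply: functional_mono => //.
      rewrite (_ : (fun s => _) = (fun s => h s * step t' s + (-1) * (h s * step t s))).
        by apply: bounded_onD => //; exact: bounded_onZ.
      by apply/funext => s; ring.
    move=> s Es; rewrite ler_wpM2r//.
    by have := hM _ Es; rewrite ler_norml => /andP[].
  have Q_in u : F t < u -> u <= F t' -> t <= quantile u <= t'.
    by move=> Ftu uFt'; apply: quantile_between => //; exact: le_trans (F_le1 t').
  pose q0 := quantile (F t').
  have /andP[tq0 q0t'] : t <= q0 <= t' by exact: Q_in.
  have near_q0 s : E s -> t <= s <= t' -> h q0 - e <= h s <= h q0 + e.
    move=> Es /andP[ts st'].
    have : `|h s - h q0| <= e.
      apply: hd => //; first exact: quantile_mem.
      by rewrite ltr_norml; apply/andP; split; lra.
    by rewrite ler_distlC => /andP[? ?]; apply/andP; split; lra.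
  have bhd : bounded_on E (fun s => h s * (step t' s - step t s)).
    rewrite (_ : (fun s => _) = (fun s => h s * step t' s + (-1) * (h s * step t s))).
      by apply: bounded_onD => //; exact: bounded_onZ.
    by apply/funext => s; ring.
  have J_bounds : (h q0 - e) * (F t' - F t) <= J t' - J t <= (h q0 + e) * (F t' - F t).
    rewrite J_E F_E -!LZ//; apply/andP; split; apply: functional_mono => //;
        (try exact: bounded_onZ) => s Es;
      (have [st|ts] := leP s t; first by
        rewrite /step st (le_trans st tt') subrr !mulr0);
      (have [st'|t's] := leP s t'; last by
        rewrite /step [s <= t]leNgt ts [s <= t']leNgt t's subrr !mulr0);
      by rewrite ler_wpM2r//; have := near_q0 _ Es; rewrite (ltW ts) st' => /(_ isT)/andP[].
  have I_bounds : (h q0 - e) * (F t' - F t) <= I (F t') - I (F t) <= (h q0 + e) * (F t' - F t).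
    rewrite I_E -(mass _ _ (ltW u0)) -!Rintegral_cst//; apply/andP; split.
      apply: le_Rintegral; [by []|exact: int_c|exact: int_h|] => u.
      rewrite /= in_itv/= => /andP[Fu uF].
      by have /andP[] := near_q0 _ (quantile_mem u) (Q_in _ Fu uF).
    apply: le_Rintegral; [by []|exact: int_h|exact: int_c|] => u.
    rewrite /= in_itv/= => /andP[Fu uF].
    by have /andP[] := near_q0 _ (quantile_mem u) (Q_in _ Fu uF).
  move: J_bounds I_bounds => /andP[J1 J2] /andP[I1 I2].
  rewrite ler_norml; apply/andP; split; nra.
have [K [_ EK]] := compact_bounded cE.
(* The interval from [a] to [b] contains [E], with [a] strictly below it, so that [F] goes from 0 to
   1. *)
pose a := - (`|K| + 2); pose b := `|K| + 2.
have Eab t : E t -> a < t <= b.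
  move=> /EK/= /(_ (`|K| + 1)); rewrite (le_lt_trans (ler_norm _)) ?ltrDl//.
  by move=> /(_ isT); rewrite ler_norml /a /b => /andP[? ?]; apply/andP; split; lra.
have Fa : F a = 0.
  rewrite -[RHS](functional_cst 0); apply: functional_eq => //.
    exact: bounded_on_cst.
  by move=> t /Eab/andP[at_ _]; rewrite /step leNgt at_.
have Fb : F b = 1.
  rewrite -[RHS](functional_cst 1); apply: functional_eq => //.
    exact: bounded_on_cst.
  by move=> t /Eab/andP[_ tb]; rewrite /step tb.
have Ja : J a = 0.
  rewrite -[RHS](functional_cst 0); apply: functional_eq => //.
    exact: bounded_on_cst.
  by move=> t /Eab/andP[at_ _]; rewrite /step leNgt at_ mulr0.
have Jb : J b = L h.
  by apply: functional_eq => // t /Eab/andP[_ tb]; rewrite /step tb mulr1.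
have ab : 0 < b - a by rewrite /a /b; have := normr_ge0 K; lra.
have I0 : I 0 = 0.
  by rewrite /I set_itvoc0 Rintegral_set0.
rewrite -Jb -[X in _ = X](_ : I 1 = _)// -Fb.
apply/eqP; rewrite -subr_eq0 -normr_eq0 eq_le normr_ge0 andbT.
apply/ler_addgt0Pr => e e0; rewrite add0r.
have [d d0 hd] := uch (e / 2) ltac:(by rewrite divr_gt0).
pose m := (Num.truncn ((b - a) / d)).+1.
pose w := (b - a) / m%:R.
have m0 : 0 < m%:R :> R by rewrite ltr0n.
have wd : w < d.
  rewrite /w ltr_pdivrMr// mulrC -ltr_pdivrMr//.
  by have := truncnS_gt ((b - a) / d).
have w0 : 0 < w by rewrite divr_gt0.
(* The local errors add up along the grid to at most [e] times the increment of [F], however many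
   grid points there are. *)
have chain k : `|(I (F (a + k%:R * w)) - J (a + k%:R * w))| <= e * F (a + k%:R * w).
  elim: k => [|k IH].
    by rewrite mul0r addr0 Fa Ja I0 subrr normr0 mulr0.
  have kk : a + k.+1%:R * w - (a + k%:R * w) = w by rewrite -natr1; ring.
  have := local (e / 2) d ltac:(by rewrite divr_gt0) hd (a + k%:R * w) (a + k.+1%:R * w).
  rewrite kk wd -subr_ge0 kk (ltW w0) => /(_ isT isT).
  rewrite (_ : 2 * (e / 2) = e); last by field.
  move=> lk.
  set A := I (F (a + k.+1%:R * w)) - J _ in lk *.
  rewrite -(subrK (I (F (a + k%:R * w)) - J (a + k%:R * w)) A).
  rewrite (le_trans (ler_normD _ _))//.
  rewrite (le_trans (lerD lk IH))//; lra.
have := chain m; rewrite (_ : a + m%:R * w = b); last first.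
  by rewrite /w; field; rewrite gt_eqF.
by rewrite Fb mulr1 distrC.
Qed.

End quantile_representation.

(** * A space-filling curve *)

Section expansions.
Context {R : realType} (B : R).
Hypothesis B1 : 1 < B.

Definition partial_expansion (u : nat -> R) n := \sum_(k < n) u k / B ^+ k.+1.

(** For nonnegative digits the partial sums increase, and this is the sum of the series. Digits are
    real numbers, because a continuous digit function also takes intermediate values. *)
Definition expansion u := sup (range (partial_expansion u)).

Let B0 : 0 < B. Proof. exact: lt_trans B1. Qed.

Let partial_le u : (forall k, 0 <= u k <= B - 1) -> forall n m,
  partial_expansion u n <= partial_expansion u (n + m) <=
  partial_expansion u n + (B ^- n - B ^- (n + m)).
Proof.
move=> u01 n; elim=> [|m /andP[IH1 IH2]]; first by rewrite addn0 subrr addr0 lexx.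
rewrite addnS {2 3}/partial_expansion big_ord_recr/= -/(partial_expansion u (n + m)).
have /andP[u0 u1] := u01 (n + m)%N.
have Bn : 0 < B ^- (n + m).+1 by rewrite invr_gt0 exprn_gt0.
apply/andP; split; first by rewrite (le_trans IH1)// lerDl mulr_ge0// ltW.
have : u (n + m)%N / B ^+ (n + m).+1 <= (B - 1) * B ^- (n + m).+1.
  by rewrite ler_wpM2r// ltW.
have -> : (B - 1) * B ^- (n + m).+1 = B ^- (n + m) - B ^- (n + m).+1.
  by rewrite exprS; field; do ?[apply/andP; split]; rewrite gt_eqF ?exprn_gt0.
lra.
Qed.

Lemma expansion_bounds u n : (forall k, 0 <= u k <= B - 1) ->
  partial_expansion u n <= expansion u <= partial_expansion u n + B ^- n.
Proof.
move=> u01; have ub : ubound (range (partial_expansion u)) (partial_expansion u n + B ^- n).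
  move=> _ [m _ <-]; have [nm|mn] := leqP n m.
    have := partial_le u01 n (m - n); rewrite subnKC// => /andP[_].
    have : 0 < B ^- m by rewrite invr_gt0 exprn_gt0.
    lra.
  have := partial_le u01 m (n - m); rewrite subnKC 1?ltnW// => /andP[+ _].
  have : 0 < B ^- n by rewrite invr_gt0 exprn_gt0.
  lra.
apply/andP; split.
  by apply: ub_le_sup; [exists (partial_expansion u n + B ^- n)|exists n].
by apply: ge_sup => //; exists (partial_expansion u 0); exists 0%N.
Qed.

Lemma small_power (e : R) : 0 < e -> exists n, B ^- n < e.
Proof.
move=> e0; have : (B^-1) ^+ n @[n --> \oo] --> (0 : R).
  by apply: cvg_expr; rewrite ger0_norm ?invr_ge0 1?ltW// invf_lt1.
move=> /cvgrPdist_lt /(_ _ e0)[n _ /(_ n (leqnn n))].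
rewrite /= sub0r normrN ger0_norm ?exprn_ge0 ?invr_ge0 1?ltW// => ne.
by exists n; rewrite -exprVn.
Qed.

Lemma expansion_unique u x : (forall k, 0 <= u k <= B - 1) ->
  (forall n, partial_expansion u n <= x <= partial_expansion u n + B ^- n) ->
  expansion u = x.
Proof.
move=> u01 ux; apply/eqP; rewrite -subr_eq0 -normr_eq0 eq_le normr_ge0 andbT.
apply/ler_addgt0Pr => e e0; rewrite add0r.
have [n ne] := small_power e0.
have /andP[? ?] := ux n; have /andP[? ?] := expansion_bounds n u01.
rewrite ler_norml; apply/andP; split; lra.
Qed.

(** A uniform limit of continuous functions: the tail after [n] terms is at most [B ^- n], whatever
    [t] is. *)
Lemma continuous_expansion (u : R -> nat -> R) :
  (forall t k, 0 <= u t k <= B - 1) -> (forall k, continuous (u ^~ k)) ->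
  continuous (fun t => expansion (u t)).
Proof.
move=> u01 cu t; apply/cvgrPdist_le => e e0.
have [n ne] := small_power (divr_gt0 e0 (ltr0n R 3)).
have : continuous (fun s => partial_expansion (u s) n).
  apply: continuous_big => [|k _ s]; first exact: add_continuous.
  by apply: cvgMr_tmp; exact: cu.
move=> /(_ t)/cvgrPdist_le /(_ (e / 3)).
rewrite divr_gt0// => /(_ isT); apply: filterS => s /=.
have /andP[? ?] := expansion_bounds n (u01 t).
have /andP[? ?] := expansion_bounds n (u01 s).
rewrite !ler_norml => /andP[? ?]; apply/andP; split; lra.
Qed.

End expansions.

(* Schoenberg's space-filling curve: the ternary digits 0 and 2 of [t], which
   the 2-periodic function [bit] reads off [3 ^ n * t], are the interleaved
   binary digits of the coordinates. *)
Section schoenberg_curve.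
Context {R : realType}.

Let c1 : R := cos (pi / 3).
Let c2 : R := cos (pi * 2 / 3).

Let pi0 : 0 < pi :> R. Proof. exact: pi_gt0. Qed.

Let c21 : c2 < c1.
Proof.
have := pi0; rewrite /c1 /c2 => ?.
by rewrite ltr_cos ?in_itv/=; [lra|apply/andP; split; lra..].
Qed.

(** An affine function of a cosine, clipped to [[0, 1]]. Since [c1] and [c2] are the cosines of
    [pi / 3] and [2 pi / 3], it equals 0 on [[0, 1/3]] and 1 on [[2/3, 1]]. *)
Definition bit (t : R) : R :=
  Num.min 1 (Num.max 0 ((c1 - cos (pi * t)) / (c1 - c2))).

Lemma bit_itv t : 0 <= bit t <= 1.
Proof.
rewrite /bit ge_min lexx/= andbT le_min ler01/=.
by rewrite le_max lexx.
Qed.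

Lemma continuous_bit : continuous bit.
Proof.
move=> t; apply: (@continuous_min R _ (fun=> 1)
  (fun t => Num.max 0 ((c1 - cos (pi * t)) / (c1 - c2)))); first exact: cvg_cst.
apply: (@continuous_max R _ (fun=> 0)
  (fun t => (c1 - cos (pi * t)) / (c1 - c2))); first exact: cvg_cst.
apply: cvgMr_tmp; apply: cvgB; first exact: cvg_cst.
apply: (@continuous_comp _ _ _ (fun t => pi * t) cos).
  by apply: cvgMl_tmp; exact: cvg_id.
exact: continuous_cos.
Qed.

Lemma bit_periodic t m : bit (t + 2 * m%:R) = bit t.
Proof.
rewrite /bit mulrDr mulrA mulr_natr -[pi * 2]/(pi * 2%:R) mulr_natr.
by rewrite (periodicn (@cosD2pi R)).
Qed.

Lemma bit_digit (b : bool) y : 0 <= y <= 1 / 3 -> bit (2 * b%:R / 3 + y) = b%:R.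
Proof.
move=> /andP[y0 y1]; have := pi0; have c12 : 0 < c1 - c2 by rewrite subr_gt0 c21.
move=> ?; rewrite /bit; case: b => /=.
  have : cos (pi * (2 * 1 / 3 + y)) <= c2.
    rewrite /c2 leNgt ltr_cos ?in_itv/=; [|apply/andP; split; nra..].
    by rewrite -leNgt; nra.
  move=> h; rewrite max_r ?min_l//.
    by rewrite ler_pdivlMr// mul1r lerD2l lerN2.
  by rewrite divr_ge0 ?(ltW c12)//; lra.
have : c1 <= cos (pi * (2 * 0 / 3 + y)).
  rewrite /c1 leNgt ltr_cos ?in_itv/=; [|apply/andP; split; nra..].
  by rewrite -leNgt; nra.
move=> h; rewrite max_l ?min_r//.
by rewrite pmulr_lle0 ?invr_gt0//; lra.
Qed.

Definition curve (D j : nat) (t : R) := expansion 2 (fun k => bit (3 ^+ (D * k + j) * t)).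

Let bit_B t : 0 <= bit t <= 2 - 1.
Proof. by rewrite (_ : 2 - 1 = 1) ?bit_itv//; ring. Qed.

Lemma continuous_curve D j : continuous (curve D j).
Proof.
apply: continuous_expansion => [|t k|k t]; [lra|exact: bit_B|].
have : continuous (bit \o (fun t => 3 ^+ (D * k + j) * t)).
  move=> s; apply: continuous_comp; last exact: continuous_bit.
  by apply: cvgMl_tmp; exact: cvg_id.
exact.
Qed.

(** A power of 3 times an even integer is even, hence a period of [bit]. This lets the curve be
    repeated on each interval [[2 i, 2 i + 1]], one for every index. *)
Lemma curve_periodic D j t m : curve D j (t + 2 * m%:R) = curve D j t.
Proof.
rewrite /curve; congr expansion; apply/funext => k.
rewrite mulrDr mulrCA -natrX -natrM; exact: bit_periodic.
Qed.

Let floor_bit (x : R) k : Num.floor (2 ^+ k.+1 * x) = 2 * Num.floor (2 ^+ k * x)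
  \/ Num.floor (2 ^+ k.+1 * x) = 2 * Num.floor (2 ^+ k * x) + 1.
Proof.
have /andP[a1 a2] := floor_itv (2 ^+ k.+1 * x).
have /andP[b1 b2] := floor_itv (2 ^+ k * x).
set a := Num.floor _ in a1 a2 *; set b := Num.floor _ in b1 b2 *.
move: a1 a2 b1 b2; rewrite exprS -mulrA; set y := 2 ^+ k * x => a1 a2 b1 b2.
have : 2 * b < a + 1.
  by rewrite -(ltr_int R) intrM intrD; lra.
have : a < 2 * b + 2.
  by rewrite -(ltr_int R) intrD intrM; move: b2; rewrite intrD; lra.
lia.
Qed.

(** The binary digit of weight [2 ^- k.+1]: the parity of the floor of [2 ^+ k.+1 * x]. *)
Let binary (x : R) k : bool := Num.floor (2 ^+ k.+1 * x) != 2 * Num.floor (2 ^+ k * x).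

Let binary_expansion x : 0 <= x < 1 -> expansion 2 (fun k => (binary x k)%:R) = x.
Proof.
move=> /andP[x0 x1]; apply: expansion_unique; first lra.
  by move=> k; rewrite ler0n (_ : 2 - 1 = 1) ?lern1 ?leq_b1//; ring.
have e2 : (2 : int)%:~R = 2 :> R by [].
have partialE n : @partial_expansion R 2 (fun k => (binary x k)%:R) n =
    (Num.floor (2 ^+ n * x))%:~R / 2 ^+ n.
  elim: n => [|n IH].
    rewrite /partial_expansion big_ord0 expr0 mul1r (_ : Num.floor x = 0) ?mul0r//.
    by apply: floor_def; rewrite x0 add0r x1.
  rewrite /partial_expansion big_ord_recr/= 
    -/(partial_expansion 2 (fun k => (binary x k)%:R) n) IH /binary.
  have p0 : (2 : R) ^+ n != 0 by rewrite gt_eqF// exprn_gt0.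
  case: (floor_bit x n) => ->.
    rewrite eqxx exprS intrM e2 mul0r addr0.
    by field.
  rewrite (_ : (_ != _) = true); last by lia.
  rewrite exprS intrD intrM e2 mulr1z mulr1n.
  by field.
move=> n; rewrite partialE.
have p0 : 0 < (2 : R) ^+ n by rewrite exprn_gt0.
have /andP[b1 b2] := floor_itv (2 ^+ n * x).
rewrite -[X in _ + X]mul1r -mulrDl ler_pdivrMr// ler_pdivlMr// [x * _]mulrC.
by rewrite b1/= (le_trans (ltW b2))// intrD.
Qed.

Lemma curve_surjective D (x : nat -> R) : (forall j, 0 <= x j < 1) ->
  exists2 t, 0 <= t <= 1 & forall j, (j < D)%N -> curve D j t = x j.
Proof.
move=> x01; pose b n := binary (x (n %% D)%N) (n %/ D)%N.
pose u n : R := 2 * (b n)%:R.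
have u01 n : 0 <= u n <= 3 - 1.
  by rewrite /u; case: (b n) => /=; apply/andP; split; lra.
have B3 : 1 < 3 :> R by lra.
pose t := expansion 3 u.
(* The integer formed by the first [n] ternary digits is even, as all digits are 0 or 2; the next
   digit is [2 * b n], and what remains is at most [1 / 3], so [bit] returns [b n]. *)
have tE n : exists2 y, 0 <= y <= 1 / 3 & exists m,
    3 ^+ n * t = 2 * (b n)%:R / 3 + y + 2 * m%:R.
  have [m mE] : exists m, 3 ^+ n * partial_expansion 3 u n = 2 * m%:R.
    elim: n => [|n [m mE]]; first by exists 0%N; rewrite /partial_expansion big_ord0 !mulr0.
    exists (3 * m + b n)%N; rewrite /partial_expansion big_ord_recr/=.
    rewrite -/(partial_expansion 3 u n) mulrDr [in X in _ + X]mulrC divfK; last first.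
      by rewrite gt_eqF ?exprn_gt0.
    by rewrite exprS -mulrA mE natrD natrM /u; ring.
  have p3 : 0 < (3 : R) ^+ n by rewrite exprn_gt0.
  have /andP[t1 t2] := @expansion_bounds R 3 B3 u n.+1 u01.
  exists (3 ^+ n * t - 2 * m%:R - 2 * (b n)%:R / 3); last by exists m; ring.
  move: t1 t2; rewrite /partial_expansion big_ord_recr/= -/(partial_expansion 3 u n).
  rewrite -/t => /(ler_wpM2l (ltW p3)) t1 /(ler_wpM2l (ltW p3)) t2.
  move: t1 t2; rewrite !mulrDr mE /u.
  rewrite (_ : 3 ^+ n * (2 * (b n)%:R / 3 ^+ n.+1) = 2 * (b n)%:R / 3); last first.
    by rewrite exprS; field; rewrite gt_eqF.
  rewrite (_ : 3 ^+ n * 3 ^- n.+1 = 1 / 3); last first.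
    by rewrite exprS; field; rewrite gt_eqF.
  by move=> ? ?; apply/andP; split; lra.
exists t.
  have := @expansion_bounds R 3 B3 u 0 u01.
  by rewrite /partial_expansion big_ord0 add0r expr0 invr1.
move=> j jD; rewrite -[RHS]binary_expansion//; congr expansion.
apply/funext => k; have [y y01 [m ->]] := tE (D * k + j)%N.
rewrite bit_periodic bit_digit// /b mulnC modnMDl modn_small// divnMDl//.
  by rewrite divn_small// addn0.
exact: leq_ltn_trans jD.
Qed.

End schoenberg_curve.

(** * Calculus on the torus *)

Section euclidean_facts.
Context {R : realType} {d : nat}.
Implicit Types (p q x y z : 'rV[R]_d) (a : R).

Lemma dotC p q : dot p q = dot q p.
Proof. by apply: eq_bigr => k _; rewrite mulrC. Qed.

Lemma dotDr p q z : dot p (q + z) = dot p q + dot p z.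
Proof. by rewrite -big_split; apply: eq_bigr => k _; rewrite mxE mulrDr. Qed.

Lemma dotZr a p q : dot p (a *: q) = a * dot p q.
Proof. by rewrite mulr_sumr; apply: eq_bigr => k _; rewrite mxE mulrCA. Qed.

Lemma dotNr p q : dot p (- q) = - dot p q.
Proof. by rewrite -scaleN1r dotZr mulN1r. Qed.

Lemma dotBr p q z : dot p (q - z) = dot p q - dot p z.
Proof. by rewrite dotDr dotNr. Qed.

Lemma dotDl p q z : dot (p + q) z = dot p z + dot q z.
Proof. by rewrite dotC dotDr !(dotC z). Qed.

Lemma dotZl a p q : dot (a *: p) q = a * dot p q.
Proof. by rewrite dotC dotZr dotC. Qed.

Lemma dotNl p q : dot (- p) q = - dot p q.
Proof. by rewrite dotC dotNr dotC. Qed.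

Lemma dot0r p : dot p 0 = 0.
Proof. by rewrite -(scale0r 0) dotZr mul0r. Qed.

Lemma dot_sq_ge0 p : 0 <= dot p p.
Proof. by apply: sumr_ge0 => k _; rewrite -expr2 sqr_ge0. Qed.

Lemma dot_delta p k : dot p (delta_mx 0 k) = p 0 k.
Proof.
rewrite /dot (bigD1 k)//= mxE !eqxx mulr1 big1 ?addr0// => j jk.
by rewrite mxE eqxx (negbTE jk) mulr0.
Qed.

Lemma enorm_ge0 p : 0 <= enorm p.
Proof. exact: sqrtr_ge0. Qed.

Lemma enorm_sq p : enorm p ^+ 2 = dot p p.
Proof. by rewrite sqr_sqrtr// dot_sq_ge0. Qed.

Lemma coord_le_norm p k : `|p 0 k| <= `|p|.
Proof.
by rewrite /Num.Def.normr/= mx_normrE (le_trans _ (le_bigmax _ _ (0, k))).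
Qed.

Lemma norm_le_coord p a : 0 <= a -> (forall k, `|p 0 k| <= a) -> `|p| <= a.
Proof.
move=> a0 pa; rewrite /Num.Def.normr/= mx_normrE.
by apply: bigmax_le => // -[i k] _; rewrite ord1.
Qed.

Lemma norm_le_enorm p : `|p| <= enorm p.
Proof.
apply: norm_le_coord => [|k]; first exact: enorm_ge0.
rewrite -sqrtr_sqr ler_wsqrtr// /dot (bigD1 k)//= -expr2 lerDl.
by apply: sumr_ge0 => j _; rewrite -expr2 sqr_ge0.
Qed.

Lemma dot_le_norm p q : `|dot p q| <= d%:R * (`|p| * `|q|).
Proof.
rewrite (le_trans (ler_norm_sum _ _ _))//.
rewrite (_ : d%:R * _ = \sum_(k < d) `|p| * `|q|); last first.
  by rewrite sumr_const card_ord mulr_natl.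
by apply: ler_sum => k _; rewrite normrM ler_pM// coord_le_norm.
Qed.

Lemma continuous_dot (T : topologicalType) (f g : T -> 'rV[R]_d) :
  continuous f -> continuous g -> continuous (fun t => dot (f t) (g t)).
Proof.
move=> cf cg; apply: continuous_big => [|k _ t]; first exact: add_continuous.
apply: cvgM.
  by apply: (@continuous_comp _ _ _ f (fun v => v 0 k)); [exact: cf|exact: coord_continuous].
by apply: (@continuous_comp _ _ _ g (fun v => v 0 k)); [exact: cg|exact: coord_continuous].
Qed.

Lemma continuous_row (T : topologicalType) (f : T -> 'rV[R]_d) :
  (forall k, continuous (fun t => f t 0 k)) -> continuous f.
Proof.
move=> cf t; apply/cvgrPdist_le => e e0.
have : \forall s \near t, forall k, `|f t 0 k - f s 0 k| <= e.
  by apply: filter_forall => k; have /cvgrPdist_le := cf k t; exact.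
apply: filterS => s fs; apply: norm_le_coord; first exact: ltW.
by move=> k; rewrite !mxE.
Qed.

End euclidean_facts.

(** * Continuous differentiability from two-sided quadratic bounds *)

Section smooth_functions.
Context {R : realType} {d : nat}.

Lemma dot_is_linear (p : 'rV[R]_d) : linear (dot p : 'rV[R]_d -> R).
Proof. by move=> a x y; rewrite dotDr dotZr. Qed.

HB.instance Definition _ (p : 'rV[R]_d) :=
  GRing.isLinear.Build R 'rV[R]_d R _ (dot p : 'rV[R]_d -> R) (dot_is_linear p).

Lemma continuous_dotr (p : 'rV[R]_d) : continuous (dot p : 'rV[R]_d -> R).
Proof.
apply: continuous_dot => x; first exact: (@cst_continuous _ _ p x).
exact: cvg_id.
Qed.

Lemma quadratic_touch_diff (f : 'rV[R]_d -> R) (p x : 'rV[R]_d) (C : R) :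
  (forall y, `|f y - f x - dot p (y - x)| <= C * dot (y - x) (y - x)) ->
  differentiable f x /\ forall h, 'd f x h = dot p h.
Proof.
move=> fC.
have fE : (f : _ -> R^o) \o shift x = cst (f x) + (dot p : _ -> R^o) +o_ (0 : 'rV[R]_d) id.
  apply/eqaddoP => e e0.
  pose a := `|C| * d%:R + 1.
  have a0 : 0 < a by rewrite ltr_wpDl// mulr_ge0.
  have : \forall h \near (0 : 'rV[R]_d), `|h| <= e / a.
    have := @nbhsx_ballx R 'rV[R]_d 0 _ (divr_gt0 e0 a0).
    apply: filterS => h; rewrite mx_norm_ball /ball_/= sub0r normrN.
    exact: ltW.
  apply: filterS => h ha.
  have := fC (h + x); rewrite addrK => fh.
  rewrite (_ : (f \o shift x - _) h = f (h + x) - f x - dot p h); last first.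
    by rewrite !fctE; ring.
  rewrite (le_trans fh)// (@le_trans _ _ (a * (`|h| * `|h|)))//.
    have hh := dot_le_norm h h.
    rewrite ger0_norm ?dot_sq_ge0// in hh.
    have h0 : 0 <= `|h| * `|h| by rewrite mulr_ge0.
    rewrite (@le_trans _ _ (`|C| * (d%:R * (`|h| * `|h|))))//.
      rewrite (@le_trans _ _ (`|C| * dot h h))//.
        by rewrite ler_wpM2r ?dot_sq_ge0// ler_norm.
      by rewrite ler_wpM2l.
    set X := `|h| * `|h| in h0 *; by rewrite /a mulrDl mul1r mulrA lerDl.
  by rewrite mulrA ler_wpM2r// mulrC -ler_pdivlMr.
have dE := diff_unique (@continuous_dotr p) fE.
split=> [|h]; last by rewrite dE.
by apply/diff_locallyP; rewrite dE; split => //; exact: continuous_dotr.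
Qed.

Lemma derive_dot_gradient (f : 'rV[R]_d -> R) x h :
  differentiable f x -> 'D_h f x = dot (gradient f x) h.
Proof.
move=> df; rewrite deriveE// {1}[h]row_sum_delta linear_sum.
apply: eq_bigr => k _; rewrite mxE linearZ/= mulrC deriveE//.
Qed.

Lemma continuous_gradient (f : 'rV[R]_d -> R) : C1 f -> continuous (gradient f).
Proof.
move=> [_ cf]; apply: continuous_row => k.
by rewrite (_ : (fun t => _) = 'D_(delta_mx 0 k) f) //; apply/funext => t; rewrite mxE.
Qed.

Lemma C1_continuous (V : normedModType R) (f : V -> R) : C1 f -> continuous f.
Proof. by move=> [df _] x; exact: differentiable_continuous. Qed.

(** The expansions from [x] to [y], from [y] to [y + h] and from [x] to [y + h] are combined so that
    the values of [f] cancel. *)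
Lemma quadratic_touch_gradient_lipschitz (f : 'rV[R]_d -> R) (P : 'rV[R]_d -> 'rV[R]_d) C :
  (forall x y, `|f y - f x - dot (P x) (y - x)| <= C * dot (y - x) (y - x)) ->
  forall x y h, `|dot (P y) h - dot (P x) h| <=
     C * (dot (y + h - x) (y + h - x) + dot h h + dot (y - x) (y - x)).
Proof.
move=> fC x y h.
have := fC x (y + h); have := fC y (y + h); have := fC x y.
rewrite [y + h - y]addrAC subrr add0r [y + h - x]addrAC dotDr.
rewrite !ler_norml => /andP[? ?] /andP[? ?] /andP[? ?]; apply/andP; split; lra.
Qed.

Lemma quadratic_touch_C1 (f : 'rV[R]_d -> R) (P : 'rV[R]_d -> 'rV[R]_d) C :
  (forall x y, `|f y - f x - dot (P x) (y - x)| <= C * dot (y - x) (y - x)) ->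
  C1 f /\ gradient f = P.
Proof.
move=> fC.
have dfE h x : 'D_h f x = dot (P x) h.
  by have [df <-] := quadratic_touch_diff (fC x); rewrite deriveE.
split; last first.
  by apply/funext => x; apply/rowP => k; rewrite mxE dfE dot_delta.
split=> [x|h x]; first by have [] := quadratic_touch_diff (fC x).
rewrite (_ : 'D_h f = fun x => dot (P x) h); last by apply/funext.
apply/(@cvgrPdist_le _ _ _ (nbhs x)) => e e0.
pose b := 6 * (`|C| + 1) * d%:R * (`|h| + 1) ^+ 2 + 1.
have h1 : 0 < `|h| + 1 by rewrite ltr_wpDl.
have b0 : 0 < b.
  rewrite /b; have := normr_ge0 C => ?.
  by rewrite ltr_wpDl// mulr_ge0 ?sqr_ge0// mulr_ge0//; lra.
have : \forall y \near x, `|y - x| <= e / b.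
  have := @nbhsx_ballx R 'rV[R]_d x _ (divr_gt0 e0 b0).
  apply: filterS => y; rewrite mx_norm_ball /ball_/= distrC.
  exact: ltW.
apply: filterS => y yx.
have [->|y_x] := eqVneq y x; first by rewrite subrr normr0 ltW.
(* scaling the direction to the length of [y - x] makes the bound linear *)
set s := `|y - x| in yx *.
have s0 : 0 < s by rewrite normr_gt0 subr_eq0.
have := quadratic_touch_gradient_lipschitz fC x y (s *: h).
rewrite !dotZr -mulrBr normrM (gtr0_norm s0) distrC.
have n1 : `|y + s *: h - x| <= s * (`|h| + 1).
  rewrite addrAC (le_trans (ler_normD _ _))// normrZ (gtr0_norm s0) -/s; lra.
have bd (z : 'rV[R]_d) : `|z| <= s * (`|h| + 1) -> dot z z <= d%:R * (s * (`|h| + 1)) ^+ 2.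
  move=> zs; have := dot_le_norm z z; rewrite ger0_norm ?dot_sq_ge0// => /le_trans; apply.
  by rewrite ler_wpM2l// expr2 ler_pM.
have d1 := bd _ n1.
have d2 : dot (s *: h) (s *: h) <= d%:R * (s * (`|h| + 1)) ^+ 2.
  by apply: bd; rewrite normrZ (gtr0_norm s0) ler_pM2l// lerDl.
have d3 : dot (y - x) (y - x) <= d%:R * (s * (`|h| + 1)) ^+ 2.
  by apply: bd; rewrite -/s ler_peMr ?lerDr// (ltW s0).
rewrite dotZr dotZl in d2.
move=> le1; rewrite -(ler_pM2l s0) (le_trans le1)//.
have C1 := ler_norm C.
have D0 : 0 <= dot (y + s *: h - x) (y + s *: h - x) by exact: dot_sq_ge0.
have D1 : 0 <= dot (y - x) (y - x) by exact: dot_sq_ge0.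
have D2 : 0 <= s * dot (s *: h) h by rewrite -dotZr dot_sq_ge0.
rewrite dotZl in D2.
rewrite dotZl.
apply: (@le_trans _ _ (`|C| * (3 * (d%:R * (s * (`|h| + 1)) ^+ 2)))).
  apply: (@le_trans _ _ (`|C| * (dot (y + s *: h - x) (y + s *: h - x) +
      s * (s * dot h h) + dot (y - x) (y - x)))).
    by rewrite ler_wpM2r//; lra.
  by rewrite ler_wpM2l//; lra.
apply: (@le_trans _ _ (s * (s * b))); last first.
  by rewrite ler_pM2l// -ler_pdivlMr.
rewrite exprMn (_ : `|C| * _ = s * (s * (3 * `|C| * d%:R * (`|h| + 1) ^+ 2))); last by ring.
rewrite !ler_pM2l// /b.
set w := d%:R * (`|h| + 1) ^+ 2.
have w0 : 0 <= w by rewrite mulr_ge0// sqr_ge0.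
rewrite (_ : 3 * _ * _ * _ = 3 * `|C| * w); last by rewrite /w; ring.
rewrite (_ : 6 * _ * _ * _ = 6 * (`|C| + 1) * w); last by rewrite /w; ring.
have := normr_ge0 C; nra.
Qed.

End smooth_functions.

(** * Periodic functions and the torus *)

Section torus_facts.
Context {R : realType} {d : nat}.
Local Open Scope quotient_scope.

Lemma torus_piP (x y : 'rV[R]_d) :
  torus_pi x = torus_pi y <-> forall k, x 0 k - y 0 k \is a Num.int.
Proof.
split=> xy.
  have /eqP : x = y %[mod {eq_quot (@lattice_equiv R d)}] by exact: xy.
  by rewrite eqmodE => /forallP.
have /eqP : x == y %[mod {eq_quot (@lattice_equiv R d)}].
  by rewrite eqmodE; apply/forallP.
exact.
Qed.

Lemma torus_piK (a : torus R d) : torus_pi (repr a) = a.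
Proof. exact: reprK. Qed.

Lemma continuous_torus_pi : continuous (@torus_pi R d).
Proof. exact: pi_continuous. Qed.

Lemma torus_pi_shift (z x y : 'rV[R]_d) :
  torus_pi x = torus_pi y -> torus_pi (x + z) = torus_pi (y + z).
Proof.
move=> /torus_piP xy; apply/torus_piP => k.
by rewrite !mxE opprD addrACA subrr addr0.
Qed.

(** The shift subtracts integer parts. With it, the compact unit cube can replace the torus in
    compactness arguments. *)
Lemma lattice_shift (x : 'rV[R]_d) : exists n : 'rV[R]_d,
  (forall y, torus_pi (y + n) = torus_pi y) /\
  forall k, 0 <= (x + n) 0 k < 1.
Proof.
exists (\row_k - (Num.floor (x 0 k))%:~R); split=> [y|k].
  by apply/torus_piP => k; rewrite !mxE addrAC subrr add0r rpredN intr_int.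
rewrite !mxE subr_ge0; have /andP[-> ] := floor_itv (x 0 k).
by rewrite ltrBlDr addrC intrD.
Qed.

Definition periodic_fun (T : Type) (g : 'rV[R]_d -> T) :=
  forall x y, torus_pi x = torus_pi y -> g x = g y.

Lemma periodic_comp_pi (T : Type) (u : torus R d -> T) : periodic_fun (u \o torus_pi).
Proof. by move=> x y /= ->. Qed.

Lemma periodic_descend (T : Type) (g : 'rV[R]_d -> T) : periodic_fun g ->
  (g \o repr) \o torus_pi = g.
Proof. by move=> pg; apply/funext => x /=; apply: pg; rewrite torus_piK. Qed.

(** A periodic function has the same difference quotients at all representatives of a point, so the
    one chosen by [repr] does not matter. *)
Lemma torus_grad_pi (u : torus R d -> R) x :
  torus_grad u (torus_pi x) = gradient (u \o torus_pi) x.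
Proof.
rewrite /torus_grad /gradient; apply/rowP => k; rewrite !mxE /derive.
have -> : (u \o torus_pi) \o shift (repr (torus_pi x)) =
    (u \o torus_pi) \o shift x.
  apply/funext => h /=; rewrite addrC [h + x]addrC.
  by rewrite (torus_pi_shift _ (torus_piK _)).
by rewrite /= torus_piK.
Qed.

Lemma torus_continuousP (Z : topologicalType) (f : torus R d -> Z) :
  continuous f <-> continuous (f \o torus_pi).
Proof. exact: quotient_continuous. Qed.

Lemma compact_cube (a b : R) :
  compact [set x : 'rV[R]_d | forall k, `[a, b]%classic (x 0 k)].
Proof.
exact: (@rV_compact R d (fun=> `[a, b]%classic) (fun=> @segment_compact R a b)).
Qed.

Lemma periodic_max (g : 'rV[R]_d -> R) : continuous g -> periodic_fun g ->
  exists x, forall y, g y <= g x.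
Proof.
move=> cg pg.
have [||x _ xmax] := @compact_EVT_max _ R g _ _ (@compact_cube 0 1).
- by exists 0 => k /=; rewrite mxE in_itv/= lexx ler01.
- by apply: continuous_subspaceT => x; exact: cg.
exists x => y; have [n [pn y01]] := lattice_shift y.
rewrite -(pg _ _ (pn y)); apply: xmax; rewrite inE/= => k.
by have /andP[y0 /ltW y1] := y01 k; rewrite in_itv/= y0 y1.
Qed.

Lemma periodic_min (g : 'rV[R]_d -> R) : continuous g -> periodic_fun g ->
  exists x, forall y, g x <= g y.
Proof.
move=> cg pg; have [||x xmax] := @periodic_max (fun x => - g x).
- by move=> x; apply: (@continuousN R R^o); exact: cg.
- by move=> x y /pg ->.
- by exists x => y; rewrite -lerN2.
Qed.

Lemma periodic_bounded (g : 'rV[R]_d -> R) : continuous g -> periodic_fun g ->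
  exists2 M, 0 <= M & forall y, `|g y| <= M.
Proof.
move=> cg pg; have [||x xmax] := @periodic_max (fun x => `|g x|).
- move=> x; apply: (@continuous_comp _ _ _ g (fun r : R => `|r|)); first exact: cg.
  exact: (@norm_continuous R R^o).
- by move=> x y /pg ->.
- by exists `|g x|.
Qed.

End torus_facts.

(** * Uniform continuity on compact sets and for periodic functions *)

Section uniform_continuity.
Context {R : realType}.

(** Only [x] has to lie in [K]; [y] may leave it. This follows from the near-covering form of
    compactness, with a radius tending to 0 from the right as parameter. *)
Lemma compact_uniform (V : normedModType R) (f : V -> R) (K : set V) :
  continuous f -> compact K -> forall e, 0 < e ->
  exists2 r, 0 < r & forall x y, K x -> `|x - y| < r -> `|f x - f y| <= e.
Proof.
move=> cf /compact_near_coveringP cK e e0.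
have : \forall r \near 0^'+, K `<=` [set x | forall y, `|x - y| < r -> `|f x - f y| <= e].
  apply: (cK _ (0^'+) (fun r => [set x | forall y, `|x - y| < r -> `|f x - f y| <= e])).
  move=> x Kx.
  have /cvgrPdist_lt /(_ (e / 2)) := cf x.
  rewrite divr_gt0// => /(_ isT) /nbhs_ballP[r /= r0 xr].
  have r2 : 0 < r / 2 by rewrite divr_gt0.
  exists (ball x (r / 2), [set s | s < r / 2]) => /=.
    by split; [exact: nbhsx_ballx|exact: nbhs_right_lt].
  move=> [x' s] /= [xx' sr] y x'y.
  rewrite -ball_normE /ball_/= in xx'.
  have fx' : `|f x - f x'| < e / 2.
    by apply: xr; rewrite -ball_normE /ball_/=; lra.
  have fy : `|f x - f y| < e / 2.
    apply: xr; rewrite -ball_normE /ball_/= -(subrKA x').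
    by rewrite (le_lt_trans (ler_normD _ _))//; lra.
  by rewrite -(subrKA (f x)) (le_trans (ler_normD _ _))// distrC; lra.
move=> fr; have [r [r0 Kr]] : exists r, 0 < r /\
    K `<=` [set x | forall y, `|x - y| < r -> `|f x - f y| <= e].
  apply: (@filter_ex _ (0^'+)); apply: filterI => //.
  exact: nbhs_right_gt.
by exists r => // x y Kx; exact: Kr.
Qed.

(** The same integer vector is added to [x] and [y]: it brings [x] into the unit cube and preserves
    [x - y], and [y] need not be in the cube. *)
Lemma periodic_uniform d (f : 'rV[R]_d * 'rV[R]_d -> R) : continuous f ->
  (forall p, periodic_fun (fun x => f (x, p))) -> forall K e, 0 < e ->
  exists2 r, 0 < r & forall x y p q, `|p| <= K -> `|x - y| < r -> `|p - q| < r ->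
    `|f (x, p) - f (y, q)| <= e.
Proof.
move=> cf pf K e e0.
have cK : compact ([set x : 'rV[R]_d | forall k, `[0, 1]%classic (x 0 k)] `*`
    [set x : 'rV[R]_d | forall k, `[- K, K]%classic (x 0 k)]).
  by apply: compact_setX; exact: compact_cube.
have [r r0 fr] := compact_uniform cf cK e0.
exists r => // x y p q pK xy pq.
have [n [pn x01]] := lattice_shift x.
rewrite -(pf p _ _ (pn x)) -(pf q _ _ (pn y)); apply: fr.
  split=> k /=; first by have /andP[? /ltW ?] := x01 k; rewrite in_itv/=; apply/andP.
  by rewrite in_itv/= -ler_norml (le_trans (coord_le_norm _ _)).
by rewrite prod_normE/= gt_max opprD addrACA subrr addr0 xy pq.
Qed.

Lemma periodic_uniform1 d (g : 'rV[R]_d -> R) : continuous g ->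
  periodic_fun g -> forall e, 0 < e ->
  exists2 r, 0 < r & forall x y, `|x - y| < r -> `|g x - g y| <= e.
Proof.
move=> cg pg e e0.
have cg1 : continuous (fun z : 'rV[R]_d * 'rV[R]_d => g z.1).
  by move=> z; apply: continuous_comp; [exact: cvg_fst|exact: cg].
have [r r0 gr] := periodic_uniform cg1 (fun p => pg) 0 e0.
exists r => // x y xy; apply: (gr x y 0 0) => //; first by rewrite normr0.
by rewrite subrr normr0.
Qed.

End uniform_continuity.

(** * A smooth periodic substitute for the squared distance *)

Section trigonometric_penalty.
Context {R : realType}.

Lemma mean_value (f df : R -> R) (a b : R) :
  (forall x : R, is_derive x (1 : R) f (df x)) ->
  exists2 c, `|c - a| <= `|b - a| & f b - f a = df c * (b - a).
Proof.
move=> fdf.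
have cf : continuous f.
  by move=> x; apply/differentiable_continuous/derivable1_diffP; case: (fdf x).
have mvt x y : x <= y -> exists2 c, x <= c <= y & f y - f x = df c * (y - x).
  move=> xy; have [|c] := @MVT_segment R f df x y xy (fun z _ => fdf z).
  - by apply: continuous_subspaceT => z; exact: cf.
  - by rewrite in_itv/= => ? ?; exists c.
have [ab|/ltW ba] := leP a b.
  have [c /andP[ac cb] fE] := mvt _ _ ab; exists c => //.
  by rewrite !ger0_norm ?subr_ge0// lerD2r.
have [c /andP[bc ca] fE] := mvt _ _ ba; exists c.
  by rewrite distrC [leRHS]distrC !ger0_norm ?subr_ge0// lerD2l lerN2.
by apply: oppr_inj; rewrite opprB fE -mulrN opprB.
Qed.

Lemma sin_lipschitz (a b : R) : `|sin b - sin a| <= `|b - a|.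
Proof.
have [c _ ->] := mean_value a b (fun x => is_derive_sin x).
by rewrite normrM ler_piMl// cos_max.
Qed.

Lemma cos_taylor (a b : R) : `|cos b - cos a + sin a * (b - a)| <= (b - a) ^+ 2.
Proof.
have [c ca ->] := mean_value a b (fun x => is_derive_cos x).
rewrite -mulrDl normrM addrC -[leRHS]real_normK ?num_real// expr2 ler_wpM2r//.
by rewrite (le_trans (sin_lipschitz c a))// distrC.
Qed.

Lemma cosDint (x : R) (m : int) : cos (x + 2 * pi * m%:~R) = cos x.
Proof.
have pos (y : R) n : cos (y + 2 * pi * n%:R) = cos y.
  rewrite (_ : 2 * pi * n%:R = pi *+ 2 *+ n); last first.
    by rewrite -mulrnA -[RHS]mulr_natr natrM mulrA [pi * _]mulrC.
  by rewrite (periodicn (@cosD2pi R)).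
case: m => n; first exact: pos.
by rewrite NegzE mulrNz mulrN -[LHS](pos _ n.+1) subrK.
Qed.

Context {d : nat}.
Implicit Types x y z : 'rV[R]_d.

Definition penalty x y : R := \sum_k (1 - cos (2 * pi * (y 0 k - x 0 k))).

Definition penalty_grad x y : 'rV[R]_d :=
  \row_k (2 * pi * sin (2 * pi * (y 0 k - x 0 k))).

Lemma penalty_ge0 x y : 0 <= penalty x y.
Proof. by apply: sumr_ge0 => k _; rewrite subr_ge0 cos_le1. Qed.

Lemma penalty_diag x : penalty x x = 0.
Proof. by rewrite /penalty big1// => k _; rewrite subrr mulr0 cos0 subrr. Qed.

Lemma penaltyC x y : penalty x y = penalty y x.
Proof.
apply: eq_bigr => k _; congr (1 - _); rewrite -cosN; congr cos.
by rewrite -mulrN opprB.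
Qed.

Lemma penalty_gradC x y : penalty_grad x y = - penalty_grad y x.
Proof.
apply/rowP => k; rewrite !mxE -mulrN -sinN; congr (_ * sin _).
by rewrite -mulrN opprB.
Qed.

Lemma penalty_periodic x : periodic_fun (penalty x).
Proof.
move=> y z /torus_piP yz; apply: eq_bigr => k _; congr (1 - _).
have /intrP[m yzm] := yz k.
rewrite -[RHS](cosDint _ m); congr cos; rewrite -yzm; ring.
Qed.

Lemma penalty_taylor x y z :
  `|penalty x z - penalty x y - dot (penalty_grad x y) (z - y)| <=
  (2 * pi) ^+ 2 * dot (z - y) (z - y).
Proof.
rewrite /penalty /dot -!sumrB (le_trans (ler_norm_sum _ _ _))// mulr_sumr.
apply: ler_sum => k _; rewrite !mxE.
have h := cos_taylor (2 * pi * (y 0 k - x 0 k)) (2 * pi * (z 0 k - x 0 k)).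
have -> : 1 - cos (2 * pi * (z 0 k - x 0 k)) - (1 - cos (2 * pi * (y 0 k - x 0 k))) -
    2 * pi * sin (2 * pi * (y 0 k - x 0 k)) * (z 0 k - y 0 k) =
  - (cos (2 * pi * (z 0 k - x 0 k)) -
  cos (2 * pi * (y 0 k - x 0 k)) + sin (2 * pi * (y 0 k - x 0 k)) *
  (2 * pi * (z 0 k - x 0 k) - 2 * pi * (y 0 k - x 0 k))) by ring.
rewrite normrN.
by rewrite (le_trans h)// le_eqVlt; apply/orP; left; apply/eqP; ring.
Qed.

Lemma penalty_C1 x : C1 (penalty x) /\ gradient (penalty x) = penalty_grad x.
Proof. by apply: quadratic_touch_C1 => y z; exact: penalty_taylor. Qed.

(** A small penalty forces every [y 0 k - x 0 k] to be close to an integer; subtracting these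
    integers from [y] gives [z]. *)
Lemma small_penalty r : 0 < r -> exists2 e, 0 < e &
  forall x y, penalty x y <= e ->
    exists2 z, torus_pi z = torus_pi y & `|z - x| < r.
Proof.
move=> r0; have pi0 : 0 < pi :> R by exact: pi_gt0.
(* The bound [1 / 4] keeps [2 * pi * s] in [[0, pi]], where the cosine decreases. *)
pose s := Num.min (r / 2) (1 / 4).
have s0 : 0 < s by rewrite lt_min; apply/andP; split; lra.
have sr : s <= r / 2 by rewrite ge_min lexx.
have s4 : s <= 1 / 4 by rewrite ge_min lexx orbT.
exists ((1 - cos (2 * pi * s)) / 2) => [|x y xy].
  rewrite divr_gt0// subr_gt0 -[ltRHS]cos0 ltr_cos ?in_itv/=.
  - by rewrite !mulr_gt0.
  - by apply/andP; split; [exact: lexx|exact: ltW].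
  - by apply/andP; split; nra.
pose m k := Num.floor (y 0 k - x 0 k + 1 / 2).
exists (\row_k (y 0 k - (m k)%:~R)) => [|].
  by apply/torus_piP => k; rewrite !mxE addrAC subrr add0r rpredN intr_int.
rewrite (@le_lt_trans _ _ s)//; last lra.
apply: norm_le_coord => [|k]; first exact: ltW.
rewrite !mxE.
have /andP[] := floor_itv (y 0 k - x 0 k + 1 / 2); rewrite -/(m k) intrD.
set w := y 0 k - _ - _ => m1 m2.
have w2 : `|w| <= 1 / 2.
  by rewrite ler_norml /w; apply/andP; split; lra.
rewrite leNgt; apply/negP => sw.
have : 1 - cos (2 * pi * s) < 1 - cos (2 * pi * `|w|).
  rewrite ltrD2l ltrN2 ltr_cos ?in_itv/=; [nra|apply/andP; split; nra..].
have -> : cos (2 * pi * `|w|) = cos (2 * pi * (y 0 k - x 0 k)).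
  rewrite -[2 * pi * `|w|]ger0_norm ?mulr_ge0// ?ltW//.
  rewrite -[in LHS](gtr0_norm (mulr_gt0 (ltr0n R 2) pi0)) -normrM normr_id cos_norm.
  rewrite -[RHS](cosDint _ (- m k)) intrN; congr cos; rewrite /w; ring.
have : 1 - cos (2 * pi * (y 0 k - x 0 k)) <= penalty x y.
  rewrite /penalty (bigD1 k)//= lerDl; apply: sumr_ge0 => j _.
  by rewrite subr_ge0 cos_le1.
have : 0 <= 1 - cos (2 * pi * s) by rewrite subr_ge0 cos_le1.
lra.
Qed.

End trigonometric_penalty.

(** * Regularization of viscosity subsolutions *)

Lemma continuous_scale (R : realType) (T : topologicalType) (f : T -> R) a :
  continuous f -> continuous (fun t => a * f t).
Proof. by move=> cf t; apply: cvgMl_tmp; exact: cf. Qed.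

Section quadratic_regularization.
Context {R : realType} {d : nat}.

Lemma dot_sqD (x y : 'rV[R]_d) : dot (x + y) (x + y) = dot x x + 2 * dot x y + dot y y.
Proof. by rewrite !dotDl !dotDr (dotC y x); ring. Qed.

Lemma dot_sq_le (a w : 'rV[R]_d) :
  dot w w <= 2 * dot a a + 2 * dot (a - w) (a - w).
Proof.
have := dot_sq_ge0 (a + (a - w)).
by rewrite !(dotDl, dotDr, dotNl, dotNr) (dotC w a); lra.
Qed.

Lemma sqr_norm_le_dot (x : 'rV[R]_d) : `|x| ^+ 2 <= dot x x.
Proof. by rewrite -enorm_sq ler_pXn2r ?nnegrE ?enorm_ge0// norm_le_enorm. Qed.

Variables (s : 'rV[R]_d -> R) (P : 'rV[R]_d -> 'rV[R]_d) (C : R).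
Hypotheses (C0 : 0 <= C)
  (sP : forall x y, s x + dot (P x) (y - x) - C * dot (y - x) (y - x) <= s y).

(** Minimality in the inf-convolution gives a touching paraboloid of opening [B] only. It improves
    to the semiconvexity constant [C], as the two-sided bound below requires. *)
Lemma semiconvex_subgradient (B : R) z0 p : 0 <= B ->
  (forall z, s z0 + dot p (z - z0) - B * dot (z - z0) (z - z0) <= s z) ->
  forall z, s z0 + dot p (z - z0) - C * dot (z - z0) (z - z0) <= s z.
Proof.
move=> B0 sB z; set w := z - z0.
(* along [z0 + t w] the opening [B] only contributes [B t ^ 2], so it disappears
   when [t -> 0] *)
have w0 : 0 <= dot w w by exact: dot_sq_ge0.
apply/ler_addgt0Pr => e e0.
pose b := B * dot w w + e + 1.
have b0 : 0 < b by rewrite /b; have := mulr_ge0 B0 w0; lra.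
pose t := e / b.
have t0 : 0 < t by rewrite divr_gt0.
have tb : t * b = e by rewrite /t divfK// gt_eqF.
have t1 : t <= 1 by rewrite ler_pdivrMr// /b; have := mulr_ge0 B0 w0; lra.
pose zt := z0 + t *: w.
have := sP zt z; have := sP zt z0; have := sB zt.
have -> : zt - z0 = t *: w by rewrite /zt addrAC subrr add0r.
have -> : z0 - zt = - (t *: w) by rewrite /zt opprD addrA subrr add0r.
have -> : z - zt = (1 - t) *: w.
  by rewrite /zt scalerBl scale1r /w opprD addrA.
rewrite !(dotNl, dotNr, dotZl, dotZr).
set D := dot w w in w0 b b0 t t0 tb t1 zt *; set a := dot p w; set c := dot _ w.
move=> h1 h2 h3.
have h4 : t * (s z0 + a - C * D) - t * e <= t * s z.
  have BD : t * (B * D) <= e.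
    by rewrite -tb ler_pM2l// /b; lra.
  have h3' := ler_wpM2l (ltW t0) h3.
  have h2' : (1 - t) * (s zt + - (t * c) - C * (t * (t * D))) <= (1 - t) * s z0.
    by rewrite ler_wpM2l ?subr_ge0//; lra.
  have t00 := ltW t0.
  have tCD : 0 <= t * t * (C * D).
    by apply: mulr_ge0; apply: mulr_ge0.
  have tBD : t * (t * (B * D)) <= t * e by rewrite ler_pM2l.
  lra.
by rewrite -(ler_pM2l t0); lra.
Qed.

Variable B : R.
Hypotheses (B0 : 0 < B) (BC : 2 * C <= B).
Variable Z : 'rV[R]_d -> 'rV[R]_d.
Hypothesis Zmin : forall x z,
  s (Z x) + B * dot (x - Z x) (x - Z x) <= s z + B * dot (x - z) (x - z).

Definition inf_convolution x := s (Z x) + B * dot (x - Z x) (x - Z x).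

Lemma inf_convolution_subgradient x z :
  s (Z x) + dot ((2 * B) *: (x - Z x)) (z - Z x) - C * dot (z - Z x) (z - Z x) <= s z.
Proof.
apply: (semiconvex_subgradient (ltW B0)) => {}z.
have := Zmin x z; rewrite [x - z](_ : _ = (x - Z x) - (z - Z x)); last first.
  by rewrite opprB addrA subrK.
set b := x - Z x; set w := z - Z x.
rewrite dot_sqD !(dotNl, dotNr, dotZl); lra.
Qed.

(** From above, [Z x] is a competitor at [y]. From below, the slope at [Z x] bounds [s (Z y)], and
    [2 * C <= B] lets the kernel absorb the term [C * dot w w]. *)
Lemma inf_convolution_touch x y :
  `|inf_convolution y - inf_convolution x - dot ((2 * B) *: (x - Z x)) (y - x)| <=
  B * dot (y - x) (y - x).
Proof.
rewrite /inf_convolution ler_norml; apply/andP; split.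
  have := inf_convolution_subgradient x (Z y).
  rewrite [y - Z y](_ : _ = (x - Z x) + ((y - x) - (Z y - Z x))); last first.
    by apply/rowP => k; rewrite !mxE; ring.
  set b := x - Z x; set a := y - x; set w := Z y - Z x.
  rewrite (dot_sqD b (a - w)) !dotZl (dotBr b a w).
  have aw : 0 <= dot (a - w) (a - w) by exact: dot_sq_ge0.
  have a0 : 0 <= dot a a by exact: dot_sq_ge0.
  have ww := dot_sq_le a w.
  have Cww : C * dot w w <= B * dot a a + B * dot (a - w) (a - w).
    apply: (le_trans (ler_wpM2l C0 ww)).
    have := ler_wpM2r a0 BC; have := ler_wpM2r aw BC; lra.
  move: Cww; lra.
have := Zmin y (Z x).
rewrite [y - Z x](_ : _ = (x - Z x) + (y - x)); last first.
  by apply/rowP => k; rewrite !mxE; ring.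
rewrite (dot_sqD (x - Z x) (y - x)) dotZl; lra.
Qed.

End quadratic_regularization.

Section subsolution_regularization.
Context {R : realType} {d : nat}.
Variables (g : 'rV[R]_d * 'rV[R]_d -> R) (f u : 'rV[R]_d -> R).
Hypotheses (cg : continuous g) (pg : forall p, periodic_fun (fun x => g (x, p)))
  (g_coercive : forall M, exists K, forall x p, g (x, p) <= M -> `|p| <= K)
  (g_convex : forall x p0, exists q, forall p,
     g (x, p0) + dot q (p - p0) <= g (x, p))
  (cf : continuous f) (pf : periodic_fun f)
  (cu : continuous u) (pu : periodic_fun u)
  (u_sub : forall a x y, 0 < a ->
     (forall z, u z - a * penalty x z <= u y - a * penalty x y) ->
     g (y, a *: penalty_grad x y) + f y <= 0).

(* [s] is the sup-convolution of [u] with the periodic kernel [a * penalty]; the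
   point where the supremum defining [s x] is reached gives the slope [P x], at
   which the viscosity inequality holds. *)
Lemma sup_convolution e : 0 < e -> exists s P C r,
  [/\ 0 <= C /\ 0 < r,
      forall x y, s x + dot (P x) (y - x) - C * dot (y - x) (y - x) <= s y,
      periodic_fun s /\ continuous s,
      forall x y, `|x - y| < r -> u x - e <= s y <= u x + e &
      forall x y, `|x - y| < r -> g (x, P y) + f x <= e].
Proof.
move=> e0; have e2 : 0 < e / 2 by rewrite divr_gt0.
have [F F0 fF] := periodic_bounded cf pf.
(* Since [- f <= F], coercivity bounds by [K] every slope at which the viscosity inequality
   holds. *)
have [K gK] := g_coercive F.
have [U U0 uU] := periodic_bounded cu pu.
have [r1 r10 gr] := periodic_uniform cg pg K e2.
have [r2 r20 fr] := periodic_uniform1 cf pf e2.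
have [r3 r30 ur] := periodic_uniform1 cu pu e0.
pose r := Num.min r1 (Num.min r2 r3) / 2.
have r0 : 0 < r by rewrite divr_gt0// !lt_min r10 r20 r30.
have [rr1 rr2 rr3] : [/\ r + r <= r1, r + r <= r2 & r + r <= r3].
  by rewrite /r -splitr !ge_min !lexx !orbT.
have [w w0 small] := @small_penalty R d r r0.
(* The kernel term at a maximum point is at most the oscillation [2 * U] of [u], so this [a] forces
   a penalty of at most [w], hence a representative within [r] of [x]. *)
pose a := 2 * U / w + 1.
have a0 : 0 < a by rewrite ltr_wpDl// divr_ge0 ?mulr_ge0// ltW.
have maxim x : exists y,
    (forall z, u z - a * penalty x z <= u y - a * penalty x y) /\ `|y - x| < r.
  have [||y ymax] := @periodic_max R d (fun z => u z - a * penalty x z).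
  - move=> z; apply: (@continuousB R R^o 'rV[R]_d u (fun z => a * penalty x z) z).
      exact: cu.
    apply: (@continuous_comp _ _ _ (penalty x) (fun t => a * t)).
      exact: (C1_continuous (penalty_C1 x).1).
    by apply: cvgMl_tmp; exact: cvg_id.
  - by move=> y z yz; rewrite (pu yz) (penalty_periodic x yz).
  have pw : penalty x y <= w.
    have := ymax x; rewrite penalty_diag mulr0 subr0 => uy.
    have : a * penalty x y <= 2 * U.
      by have := uU x; have := uU y; rewrite !ler_norml => /andP[? ?] /andP[? ?]; lra.
    rewrite mulrC -ler_pdivlMr// => /le_trans; apply.
    by rewrite ler_pdivrMr// /a mulrDr mulr1 mulrCA divff ?gt_eqF// mulr1 lerDl ltW.
  have [z zy zx] := small _ _ pw.
  exists z; split=> // z'; rewrite (pu zy) (penalty_periodic x zy).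
  exact: ymax.
have [Y Ymax] := choice maxim.
pose s x := u (Y x) - a * penalty x (Y x).
pose P x := a *: penalty_grad x (Y x).
have s_ge x y : u y - a * penalty x y <= s x by have [+ _] := Ymax x.
have Yr x : `|Y x - x| < r by have [_] := Ymax x.
have gP x : g (Y x, P x) + f (Y x) <= 0 by have [? _] := Ymax x; exact: u_sub.
have PK x : `|P x| <= K.
  apply: (gK (Y x)); have := gP x; have := fF (Y x); rewrite ler_norml => /andP[? ?]; lra.
pose C := a * (2 * pi) ^+ 2.
have C0 : 0 <= C by rewrite mulr_ge0 ?sqr_ge0// ltW.
(* [Y x] is a competitor in the supremum defining [s y]; by symmetry, the Taylor bound of the
   penalty is used in its first argument. *)
have sP x y : s x + dot (P x) (y - x) - C * dot (y - x) (y - x) <= s y.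
  apply: (le_trans _ (s_ge y (Y x))).
  have := penalty_taylor (Y x) x y.
  rewrite ler_norml => /andP[_]; rewrite penalty_gradC dotNl => h.
  have := ler_wpM2l (ltW a0) h.
  by rewrite /s /P /C dotZl (penaltyC y) (penaltyC x); lra.
clearbody C.
have us x : u x <= s x.
  by have := s_ge x x; rewrite penalty_diag mulr0 subr0.
have su x : s x <= u (Y x).
  by rewrite /s lerBlDr lerDl mulr_ge0 ?penalty_ge0// ltW.
exists s, P, C, r; split => //.
- split=> [x y xy|x].
    have le_s (x' y' : 'rV[R]_d) : torus_pi x' = torus_pi y' -> s x' <= s y'.
      move=> xy'; apply: (le_trans _ (s_ge y' (Y x'))).
      by rewrite /s penaltyC (penalty_periodic _ xy') penaltyC.
    by apply/eqP; rewrite eq_le !le_s.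
  apply/(@cvgrPdist_le _ _ _ (nbhs x)) => h h0.
  pose b := d%:R * (K + C) + 1.
  have K0 : 0 <= K by rewrite (le_trans _ (PK x)).
  have b0 : 0 < b by rewrite ltr_wpDl// mulr_ge0// addr_ge0.
  have hb0 : 0 < Num.min 1 (h / b) by rewrite lt_min ltr01 divr_gt0.
  have bnd (x' y' : 'rV[R]_d) : `|y' - x'| <= 1 -> `|y' - x'| <= h / b -> s x' - s y' <= h.
    move=> d1 db.
    have := sP x' y'.
    have dp := dot_le_norm (P x') (y' - x'); rewrite ler_norml in dp.
    move: dp => /andP[dp _].
    have dq := dot_le_norm (y' - x') (y' - x'); rewrite ler_norml in dq.
    move: dq => /andP[_ dq].
    have n0 := normr_ge0 (y' - x').
    have dp' : d%:R * (`|P x'| * `|y' - x'|) <= d%:R * K * `|y' - x'|.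
      by rewrite -mulrA ler_wpM2l// ler_wpM2r.
    have dq' : C * dot (y' - x') (y' - x') <= d%:R * C * `|y' - x'|.
      rewrite [d%:R * C]mulrC -mulrA ler_wpM2l// (le_trans dq)// ler_wpM2l//.
      by rewrite -[leRHS]mulr1 ler_wpM2l.
    have : b * `|y' - x'| <= h by rewrite mulrC -ler_pdivlMr.
    rewrite /b; move: n0 dp dp' dq' => /=; lra.
  have := @nbhsx_ballx R 'rV[R]_d x _ hb0.
  apply: filterS => y; rewrite mx_norm_ball /ball_/= lt_min => /andP[/ltW y1 /ltW yb].
  by rewrite ler_norml lerNl opprB !bnd// distrC.
- move=> x y xy; have := us y; have := su y.
  have yx : `|x - y| < r3 by rewrite (lt_le_trans xy)// (le_trans _ rr3)// lerDl ltW.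
  have yYx : `|x - Y y| < r3.
    rewrite -(subrKA y) (le_lt_trans (ler_normD _ _))// (lt_le_trans _ rr3)// ltrD//.
    by rewrite distrC.
  have := ur _ _ yx; have := ur _ _ yYx.
  rewrite !ler_norml => /andP[? ?] /andP[? ?] ? ?; apply/andP; split; lra.
- move=> x y xy.
  have xY : `|x - Y y| < r + r.
    by rewrite -(subrKA y) (le_lt_trans (ler_normD _ _))// ltrD// distrC.
  have := gr x (Y y) (P y) (P y) (PK y) (lt_le_trans xY rr1).
  rewrite subrr normr0 => /(_ r10).
  have := fr x (Y y) (lt_le_trans xY rr2).
  by have := gP y; rewrite !ler_norml => ? /andP[? ?] /andP[? ?]; lra.
Qed.

Lemma subsolution_regularization e : 0 < e -> exists phi,
  [/\ C1 phi, periodic_fun phi, forall x, `|phi x - u x| <= e &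
      forall x, g (x, gradient phi x) + f x <= e].
Proof.
move=> e0; have [s [P [C [r [[C0 r0] sP [ps cs] su gP]]]]] :=
  sup_convolution (divr_gt0 e0 (ltr0n R 2)).
have [S S0 sS] := periodic_bounded cs ps.
pose r2 := r / 2.
have r20 : 0 < r2 by rewrite divr_gt0.
(* The first term gives [2 * C <= B]; the second makes the kernel exceed the oscillation of [s]
   beyond distance [r2], so a minimum over the cube [D] is global. *)
pose B := 2 * C + (2 * S + 1) / r2 ^+ 2.
have S1 : 0 < 2 * S + 1 by rewrite ltr_wpDl// mulr_ge0.
have B0 : 0 < B by rewrite ltr_wpDl ?mulr_ge0// divr_gt0// exprn_gt0.
have BC : 2 * C <= B by rewrite lerDl divr_ge0 ?sqr_ge0// ltW.
have minim x : exists z, (forall z', s z + B * dot (x - z) (x - z) <=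
    s z' + B * dot (x - z') (x - z')) /\ `|x - z| <= r2.
  pose D := [set z : 'rV[R]_d | forall k, `[x 0 k - r2, x 0 k + r2]%classic (z 0 k)].
  have inD z : D z <-> `|x - z| <= r2.
    split=> [Dz|xz k].
      apply: norm_le_coord => [|k]; first exact: ltW.
      have := Dz k; rewrite /= !mxE in_itv/= => /andP[? ?].
      by rewrite ler_norml; apply/andP; split; lra.
    have := le_trans (coord_le_norm (x - z) k) xz.
    by rewrite !mxE ler_norml /= in_itv/= => /andP[? ?]; apply/andP; split; lra.
  have cD : compact D.
    exact: (@rV_compact R d (fun k => `[x 0 k - r2, x 0 k + r2]%classic)
      (fun=> @segment_compact R _ _)).
  have D0 : D !=set0 by exists x; apply/inD; rewrite subrr normr0 ltW.
  have ch : continuous (fun z : 'rV[R]_d => s z + B * dot (x - z) (x - z)).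
    have cxz : continuous (fun z : 'rV[R]_d => x - z).
      move=> z; apply: (@continuousB R 'rV[R]_d _ (fun=> x) id z).
        exact: (@cst_continuous _ _ x z).
      exact: cvg_id.
    have cd := continuous_dot cxz cxz.
    move=> z; apply: (@continuousD R R^o _ s (fun z => B * dot (x - z) (x - z)) z).
      exact: cs.
    exact: continuous_scale cd z.
  have [|z /[!inE] Dz zmin] := @compact_EVT_min _ R
      (fun z => s z + B * dot (x - z) (x - z)) _ D0 cD.
    by apply: continuous_subspaceT => z; exact: ch.
  exists z; split; last exact/inD.
  move=> z'; have [Dz'|NDz'] := pselect (D z'); first by apply: zmin; rewrite inE.
  have := zmin x; rewrite inE subrr dot0r mulr0 addr0 => /(_ _)/le_trans; apply.
    by apply/inD; rewrite subrr normr0 ltW.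
  have xz' : r2 < `|x - z'| by rewrite ltNge; apply/negP => /inD.
  have : 2 * S + 1 <= B * dot (x - z') (x - z').
    apply: (@le_trans _ _ (B * r2 ^+ 2)).
      rewrite /B (mulrDl (2 * C)) divfK ?gt_eqF ?exprn_gt0// lerDr.
      by rewrite mulr_ge0 ?sqr_ge0// mulr_ge0.
    rewrite ler_pM2l// (le_trans _ (sqr_norm_le_dot _))//.
    by rewrite ler_pXn2r ?nnegrE// ltW.
  have := sS x; have := sS z'; rewrite !ler_norml => /andP[? ?] /andP[? ?]; lra.
have [Z ZP] := choice minim.
have Zmin x z : s (Z x) + B * dot (x - Z x) (x - Z x) <= s z + B * dot (x - z) (x - z).
  by have [+ _] := ZP x.
have Zr x : `|x - Z x| <= r2 by have [_] := ZP x.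
pose phi := inf_convolution s B Z.
have [phiC1 phiG] := quadratic_touch_C1 (inf_convolution_touch C0 sP B0 BC Zmin).
exists phi; split => //.
- have le_phi x y : torus_pi x = torus_pi y -> phi x <= phi y.
    move=> xy; have := Zmin x (Z y + (x - y)).
    rewrite (ps (Z y + (x - y)) (Z y)); last first.
      apply/torus_piP => k; rewrite !mxE addrAC subrr add0r.
      by move/torus_piP : xy.
    by rewrite (_ : x - (Z y + (x - y)) = y - Z y)//; apply/rowP => k; rewrite !mxE; ring.
  by move=> x y xy; apply/eqP; rewrite eq_le !le_phi.
- move=> x.
  have phis : phi x <= s x.
    by have := Zmin x x; rewrite subrr dot0r mulr0 addr0.
  have sphi : s (Z x) <= phi x.
    by rewrite /phi /inf_convolution lerDl mulr_ge0 ?dot_sq_ge0// ltW.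
  have xx : `|x - x| < r by rewrite subrr normr0.
  have xZ : `|x - Z x| < r by rewrite (le_lt_trans (Zr x))// /r2; lra.
  have /andP[? ?] := su _ _ xx; have /andP[? ?] := su _ _ xZ.
  rewrite ler_norml; apply/andP; split; lra.
- move=> x; rewrite phiG; set p0 := _ *: _.
  (* [q] is a subgradient of the convex function [g (x, _)] at [p0]. Semiconvexity of [s] between
     [Z x] and [Z x + t *: q] gives [dot p0 q <= dot (P z) q] up to [2 * t * C * dot q q]; hence
     [g (x, p0)] exceeds [g (x, P z)] by a small error at most. *)
  have [q gq] := g_convex x p0.
  pose t := Num.min (r2 / (`|q| + 1)) (e / (4 * (C * dot q q + 1))).
  have q1 : 0 < `|q| + 1 by rewrite ltr_wpDl.
  have Cq : 0 <= C * dot q q by rewrite mulr_ge0// dot_sq_ge0.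
  have Cq1 : 0 < 4 * (C * dot q q + 1) by rewrite mulr_gt0// ltr_wpDl.
  have t0 : 0 < t by rewrite lt_min !divr_gt0.
  have tq : t * `|q| < r2.
    rewrite (@lt_le_trans _ _ (t * (`|q| + 1)))//; first by rewrite ltr_pM2l// ltrDl.
    by rewrite -ler_pdivlMr// ge_min lexx.
  have tC : t * (4 * (C * dot q q + 1)) <= e.
    by rewrite -ler_pdivlMr// ge_min lexx orbT.
  pose z := Z x + t *: q.
  have zZ : z - Z x = t *: q by rewrite /z addrAC subrr add0r.
  have xz : `|x - z| < r.
    rewrite -(subrKA (Z x)) (le_lt_trans (ler_normD _ _))//.
    rewrite distrC [X in _ + X]distrC zZ normrZ (gtr0_norm t0) distrC.
    by have := Zr x; move: tq; rewrite /r2; lra.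
  have := inf_convolution_subgradient C0 sP B0 Zmin x z; rewrite -/p0 zZ.
  move: p0 gq => {phiG} p0 gq.
  have := sP z (Z x); have := gP _ _ xz; have := gq (P z).
  rewrite -[Z x - z]opprB zZ !(dotNl, dotNr, dotZl, dotZr, dotBr).
  rewrite (dotC q (P z)) (dotC q p0).
  set a := dot (P z) q; set b := dot p0 q.
  move=> h1 h2 h3 h4.
  have : t * (b - a) <= t * (e / 2).
    have : t * (t * (4 * (C * dot q q + 1))) <= t * e by rewrite ler_pM2l.
    have : 0 <= t * t by rewrite mulr_ge0 ?ltW.
    nra.
  rewrite ler_pM2l// => ?; lra.
Qed.

End subsolution_regularization.

Lemma periodic_bounded2 (R : realType) d (f : 'rV[R]_d * 'rV[R]_d -> R) :
  continuous f -> (forall p, periodic_fun (fun x => f (x, p))) -> forall K,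
  exists2 M, 0 <= M & forall x p, `|p| <= K -> `|f (x, p)| <= M.
Proof.
move=> cf pf K.
have cK : compact ([set x : 'rV[R]_d | forall k, `[0, 1]%classic (x 0 k)] `*`
    [set x : 'rV[R]_d | forall k, `[- K, K]%classic (x 0 k)]).
  by apply: compact_setX; exact: compact_cube.
have cfK : {within [set x : 'rV[R]_d | forall k, `[0, 1]%classic (x 0 k)] `*`
    [set x : 'rV[R]_d | forall k, `[- K, K]%classic (x 0 k)], continuous (f : _ -> R^o)}.
  by apply: continuous_subspaceT => z; exact: cf.
have [M [_ fM]] := compact_bounded (continuous_compact cfK cK).
exists (`|M| + 1) => [|x p pK]; first by rewrite addr_ge0.
have [n [pn x01]] := lattice_shift x.
rewrite -(pf p _ _ (pn x)); apply: fM; first by rewrite ltr_pwDr// ler_norm.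
exists (x + n, p) => //; split=> k /=.
  by have /andP[? /ltW ?] := x01 k; rewrite in_itv/=; apply/andP.
by rewrite in_itv/= -ler_norml (le_trans (coord_le_norm _ _)).
Qed.

Section C1_algebra.
Context {R : realType} {d : nat}.

Lemma C1_lincomb (a b : R) (f g : 'rV[R]_d -> R) : C1 f -> C1 g ->
  C1 (fun x => a * f x + b * g x) /\
  forall x, gradient (fun x => a * f x + b * g x) x =
            a *: gradient f x + b *: gradient g x.
Proof.
move=> [df cf] [dg cg].
have E : (fun x => a * f x + b * g x) = (a *: (f : _ -> R^o) + b *: (g : _ -> R^o)) by [].
have dE h x : 'D_h (fun x => a * f x + b * g x) x = a * 'D_h f x + b * 'D_h g x.
  have fx : derivable (f : _ -> R^o) x h by exact: diff_derivable.
  have gx : derivable (g : _ -> R^o) x h by exact: diff_derivable.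
  by rewrite E deriveD ?deriveZ//; exact: derivableZ.
split; last by move=> x; apply/rowP => k; rewrite !mxE dE.
split=> [x|h x].
  by rewrite E; apply: differentiableD; apply: differentiableZ; [exact: df|exact: dg].
rewrite (_ : 'D_h _ = fun x => a * 'D_h f x + b * 'D_h g x); last exact/funext.
apply: (@continuousD R R^o _ (fun x => a * 'D_h f x) (fun x => b * 'D_h g x)).
  by apply: continuous_scale; exact: cf.
by apply: continuous_scale; exact: cg.
Qed.

End C1_algebra.

(** * The Hamiltonian, its velocities and its tangents *)

Section hamiltonian_facts.
Context {R : realType} {d n : nat}.
Variable H : torus R d -> 'rV[R]_d -> idx n -> R.

Definition lift_H (i : idx n) (z : 'rV[R]_d * 'rV[R]_d) : R := H (torus_pi z.1) z.2 i.

(* Velocities are parametrised by momenta: [velocity] is [D_p H], and there the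
   Lagrangian takes the value [action_density]. *)
Definition velocity (i : idx n) (z : 'rV[R]_d * 'rV[R]_d) : 'rV[R]_d :=
  \row_k 'D_(0, delta_mx 0 k) (lift_H i) z.

Definition action_density (i : idx n) (z : 'rV[R]_d * 'rV[R]_d) : R :=
  dot z.2 (velocity i z) - lift_H i z.

Hypothesis H_C2 : hamiltonian_C2 H.

Lemma continuous_lift_H i : continuous (lift_H i).
Proof. by have [+ _] := H_C2 i; exact: C1_continuous. Qed.

Lemma periodic_lift_H i p : periodic_fun (fun x => lift_H i (x, p)).
Proof. by move=> x y; rewrite /lift_H /= => ->. Qed.

Lemma continuous_velocity i : continuous (velocity i).
Proof.
apply: continuous_row => k; have [[_ cH] _] := H_C2 i.
rewrite (_ : (fun t => _) = 'D_(0, delta_mx 0 k) (lift_H i)); first exact: cH.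
by apply/funext => z; rewrite mxE.
Qed.

Lemma dot_velocity i z h : dot (velocity i z) h = 'D_(0, h) (lift_H i) z.
Proof.
have dH : differentiable (lift_H i) z by have [[+ _] _] := H_C2 i; exact.
rewrite deriveE//.
have -> : (0 : 'rV[R]_d, h) = \sum_k h 0 k *: (0 : 'rV[R]_d, delta_mx 0 k : 'rV[R]_d).
  rewrite {1}[h]row_sum_delta.
  have : forall (s : seq 'I_d),
    (0 : 'rV[R]_d, \sum_(k <- s) h 0 k *: (delta_mx 0 k : 'rV[R]_d)) =
    \sum_(k <- s) h 0 k *: (0 : 'rV[R]_d, delta_mx 0 k : 'rV[R]_d).
    elim=> [|k s IH]; first by rewrite !big_nil.
    rewrite !big_cons -IH.
    transitivity (h 0 k *: (0 : 'rV[R]_d) + 0, h 0 k *: (delta_mx 0 k : 'rV[R]_d) +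
      \sum_(j <- s) h 0 j *: (delta_mx 0 j : 'rV[R]_d)) => //.
    by rewrite scaler0 addr0.
  exact.
rewrite linear_sum; apply: eq_bigr => k _.
by rewrite linearZ/= mxE deriveE// mulrC.
Qed.

Lemma velocity_periodic i p : periodic_fun (fun x => velocity i (x, p)).
Proof.
move=> x y xy; apply/rowP => k; rewrite !mxE /derive.
have -> : lift_H i \o shift (x, p) = lift_H i \o shift (y, p).
  apply/funext => -[z q] /=; rewrite /lift_H /= -[z + x]addrC -[z + y]addrC.
  by rewrite (torus_pi_shift z xy).
by rewrite /lift_H /= xy.
Qed.

Lemma periodic_action_density i p : periodic_fun (fun x => action_density i (x, p)).
Proof.
move=> x y xy.
by rewrite /action_density /= (velocity_periodic i p xy) (periodic_lift_H i p xy).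
Qed.

Lemma continuous_action_density i : continuous (action_density i).
Proof.
move=> z; apply: (@continuousB R R^o _ (fun z => dot z.2 (velocity i z)) (lift_H i) z).
  apply: continuous_dot; last exact: continuous_velocity.
  by move=> x; exact: cvg_snd.
exact: continuous_lift_H.
Qed.

Hypothesis H_convex : forall x i,
  convex_function [set: convex_lmodType 'rV[R]_d] (fun p => H x p i).

(** By convexity, the difference quotients from [p0] towards [p] are at most the full increment; the
    derivative is their limit. *)
Lemma convex_tangent i x p0 p :
  lift_H i (x, p0) + dot (velocity i (x, p0)) (p - p0) <= lift_H i (x, p).
Proof.
rewrite dot_velocity -lerBrDl; set h := p - p0.
have : derivable (lift_H i) (x, p0) (0, h).
  by apply: diff_derivable; have [[+ _] _] := H_C2 i; exact.
move=> /cvgrPdist_lt dH; apply/ler_addgt0Pr => e e0.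
have /nbhs_ballP[r /= r0 rP] := dH _ e0.
pose t := Num.min (r / 2) 1.
have t0 : 0 < t by rewrite lt_min divr_gt0//=.
have tr : t < r by rewrite gt_min; apply/orP; left; lra.
have t1 : t <= 1 by rewrite ge_min lexx orbT.
have : ball 0 r t by rewrite /ball/= sub0r normrN gtr0_norm.
move=> /rP /(_ (lt0r_neq0 t0)).
rewrite -/(derive _ _ _) ltr_distlC => /andP[+ _].
have : t^-1 *: ((lift_H i \o shift (x, p0)) (t *: (0, h)) - lift_H i (x, p0)) <=
    lift_H i (x, p) - lift_H i (x, p0).
  rewrite -[leLHS]/(t^-1 * _) ler_pdivrMl//.
  have : H (torus_pi x) (t *: p + (1 - t) *: p0) i <=
      t * H (torus_pi x) p i + (1 - t) * H (torus_pi x) p0 i.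
    exact: (H_convex (torus_pi x) i (Itv01 (ltW t0) t1)
      (mem_setT (p : convex_lmodType _)) (mem_setT (p0 : convex_lmodType _))).
  rewrite /lift_H /= scaler0 add0r.
  rewrite (_ : t *: p + (1 - t) *: p0 = t *: h + p0); last first.
    by rewrite /h; apply/rowP => k; rewrite !mxE; ring.
  lra.
lra.
Qed.

Hypothesis H_superlinear : unif_coercive (fun x p i => H x p i / enorm p).

Lemma lift_H_coercive i M : exists K, forall x p, lift_H i (x, p) <= M -> `|p| <= K.
Proof.
have [K HK] := H_superlinear (`|M| + 1).
(* The 1 makes [enorm p] exceed 1, so the division by it is genuine and [(|M| + 1) * enorm p]
   exceeds [M]. *)
exists (Num.max K 1) => x p; apply: contraLR; rewrite -!ltNge => pK.
have {}pK : Num.max K 1 < enorm p by rewrite (lt_le_trans pK)// norm_le_enorm.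
move: pK; rewrite gt_max => /andP[/ltW pK p1].
have := HK (torus_pi x) p i pK; rewrite ler_pdivlMr ?(lt_trans _ p1)//.
apply: lt_le_trans; rewrite (le_lt_trans (ler_norm M))//.
have := normr_ge0 M; nra.
Qed.

End hamiltonian_facts.

(** * Comparison with strict subsolutions *)

Section comparison.
Context {R : realType} {d n : nat}.
Variables (H : torus R d -> 'rV[R]_d -> idx n -> R) (c : idx n -> idx n -> R).
Hypotheses (c_ge0 : forall i j, 0 <= c i j) (H_C2 : hamiltonian_C2 H)
  (H_convex : forall x i,
     convex_function [set: convex_lmodType 'rV[R]_d] (fun p => H x p i))
  (H_superlinear : unif_coercive (fun x p i => H x p i / enorm p)).

Implicit Types (v phi : torus R d -> idx n -> R).

Lemma coupling_lincomb a b phi psi x i :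
  coupling c (fun x i => a * phi x i + b * psi x i) x i =
  a * coupling c phi x i + b * coupling c psi x i.
Proof. by rewrite /coupling !mulr_sumr -big_split; apply: eq_bigr => j _ /=; ring. Qed.

Lemma continuous_coupling v i : (forall j, continuous (v ^~ j)) ->
  continuous (fun x => coupling c v x i).
Proof.
move=> cv; apply: continuous_big => [|j _]; first exact: add_continuous.
apply: continuous_scale => x.
by apply: (@continuousB R R^o _ (v ^~ i) (v ^~ j)); exact: cv.
Qed.

Lemma continuous_comp_pi (u : torus R d -> R) : continuous u -> continuous (u \o torus_pi).
Proof. by move=> /torus_continuousP. Qed.

(** Each equation is regularized on its own, with the coupling frozen at [v] as a continuous
    zero-order term. Putting the regularized functions back into the coupling costs at most
    [2 * S * e1]. *)
Lemma smooth_subsolution v : viscosity_subsolution H c v -> forall e, 0 < e ->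
  exists phi, [/\ forall i, torus_C1 (phi ^~ i),
    forall x i, `|phi x i - v x i| <= e &
    forall x i, H x (torus_grad (phi ^~ i) x) i + coupling c phi x i <= e].
Proof.
move=> [cv v_sub] e e0.
pose S := \sum_i \sum_j c i j.
have S0 : 0 <= S by apply: sumr_ge0 => i _; exact: sumr_ge0.
pose e1 := e / (2 * S + 1).
have S1 : 0 < 2 * S + 1 by rewrite ltr_wpDl// mulr_ge0.
have e10 : 0 < e1 by rewrite divr_gt0.
have eE : e1 * (2 * S + 1) = e by rewrite divfK// gt_eqF.
have reg i := @subsolution_regularization R d (lift_H H i)
  ((fun x => coupling c v x i) \o torus_pi) ((v ^~ i) \o torus_pi)
  (@continuous_lift_H R d n H H_C2 i) (@periodic_lift_H R d n H i)
  (lift_H_coercive H_superlinear i)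
  (fun x p0 => ex_intro _ (velocity H i (x, p0)) (convex_tangent H_C2 H_convex i x p0))
  (continuous_comp_pi (@continuous_coupling v i cv)) (@periodic_comp_pi _ _ _ _)
  (continuous_comp_pi (cv i)) (@periodic_comp_pi _ _ _ _).
have {}reg i : exists phi : 'rV[R]_d -> R, [/\ C1 phi, periodic_fun phi,
    forall x, `|phi x - v (torus_pi x) i| <= e1 &
    forall x, lift_H H i (x, gradient phi x) + coupling c v (torus_pi x) i <= e1].
  apply: (reg i _ e1 e10) => a x y a0 ymax.
  pose u := (fun z => a * penalty x z) \o (@repr _ (torus R d)).
  have pa : periodic_fun (fun z => a * penalty x z).
    by move=> z z' /(penalty_periodic x) ->.
  have uE : u \o torus_pi = fun z => a * penalty x z by exact: periodic_descend.
  (* The zero coefficient turns the linear combination into the scalar multiple [a * penalty x]. *)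
  have [aC1 agrad] := C1_lincomb a 0 (penalty_C1 x).1 (penalty_C1 x).1.
  have E : (fun z => a * penalty x z) = (fun z => a * penalty x z + 0 * penalty x z).
    by apply/funext => z; rewrite mul0r addr0.
  have uC1 : torus_C1 u by rewrite /torus_C1 uE E.
  have := v_sub i u (torus_pi y) uC1.
  rewrite torus_grad_pi uE E agrad scale0r addr0 (penalty_C1 x).2; apply.
  move=> z; rewrite -(torus_piK z) -[u (torus_pi (repr z))]/((u \o torus_pi) _).
  by rewrite -[u (torus_pi y)]/((u \o torus_pi) _) uE; exact: ymax.
have [phi phiP] := choice reg.
pose Phi (x : torus R d) i := phi i (repr x).
have PhiE i : (Phi ^~ i) \o torus_pi = phi i.
  by apply: periodic_descend; have [] := phiP i.
have near_v x i : `|Phi x i - v x i| <= e1.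
  by have [_ _ + _] := phiP i => /(_ (repr x)); rewrite torus_piK.
have e1e : e1 <= e.
  have : 0 <= e1 * S by rewrite mulr_ge0 ?(ltW e10).
  by rewrite -eE; lra.
exists Phi; split=> [i|x i|x i].
- by rewrite /torus_C1 PhiE; have [] := phiP i.
- exact: le_trans e1e.
- have [_ _ _ /(_ (repr x))] := phiP i.
  rewrite -PhiE -torus_grad_pi torus_piK /lift_H /= torus_piK => h.
  have : coupling c Phi x i - coupling c v x i <= e1 * (2 * S).
    rewrite /coupling -sumrB.
    apply: (@le_trans _ _ (\sum_j c i j * (2 * e1))).
      apply: ler_sum => j _; rewrite -mulrBr ler_wpM2l//.
      have := near_v x i; have := near_v x j; rewrite !ler_norml => /andP[? ?] /andP[? ?]; lra.
    rewrite -mulr_suml; have cS : \sum_j c i j <= S.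
      by rewrite /S [leRHS](bigD1 i)//= lerDl; apply: sumr_ge0 => k _; exact: sumr_ge0.
    have := ler_wpM2r (ltW e10) cS; lra.
  lra.
Qed.

Lemma min_torus_idx (u : torus R d -> idx n -> R) : (forall i, continuous (u ^~ i)) ->
  exists (x : 'rV[R]_d) i, forall y j, u (torus_pi x) i <= u y j.
Proof.
move=> cu; have minim i : exists x : 'rV[R]_d, forall y, u (torus_pi x) i <= u (torus_pi y) i.
  exact: (periodic_min (continuous_comp_pi (cu i)) (@periodic_comp_pi _ _ _ _)).
have [X XP] := choice minim.
have i0 : idx n := ord0.
exists (X [arg min_(j < i0) u (torus_pi (X j)) j]%O).
exists [arg min_(j < i0) u (torus_pi (X j)) j]%O.
case: arg_minP => // i _ imin y j.
by rewrite (le_trans (imin j isT))// -(torus_piK y).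
Qed.

Lemma bounded_torus_idx (u : torus R d -> idx n -> R) : (forall i, continuous (u ^~ i)) ->
  exists2 M, 0 <= M & forall x i, `|u x i| <= M.
Proof.
move=> cu; have bnd i : exists M, 0 <= M /\ forall x : 'rV[R]_d, `|u (torus_pi x) i| <= M.
  have [M M0 uM] := periodic_bounded (continuous_comp_pi (cu i)) (@periodic_comp_pi _ _ _ _).
  by exists M.
have [M MP] := choice bnd.
exists (\sum_i M i) => [|x i]; first by apply: sumr_ge0 => i _; have [] := MP i.
have [_ /(_ (repr x))] := MP i; rewrite torus_piK => /le_trans; apply.
by rewrite (bigD1 i)//= lerDl; apply: sumr_ge0 => j _; have [] := MP j.
Qed.

Lemma torus_C1_continuous (u : torus R d -> R) : torus_C1 u -> continuous u.
Proof. by move=> /C1_continuous uC; exact/torus_continuousP. Qed.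

Variables v1 v2 : torus R d -> idx n -> R.
Variable K : R.
Hypotheses (K0 : 0 <= K) (v1_sub : viscosity_subsolution H c v1)
  (v2_sup : viscosity_supersolution H c v2)
  (v2_lip : forall i x y, `|v2 (torus_pi x) i - v2 (torus_pi y) i| <= K * enorm (x - y)).

(** The integrand of the closedness condition at the velocity [D_p H] of the momentum [z.2]. *)
Definition test_density (phi : torus R d -> idx n -> R) (i : idx n)
    (z : 'rV[R]_d * 'rV[R]_d) : R :=
  dot (velocity H i z) (torus_grad (phi ^~ i) (torus_pi z.1)) +
  coupling c phi (torus_pi z.1) i.

Lemma test_density_lincomb a b f g i z :
  (forall i, torus_C1 (f ^~ i)) -> (forall i, torus_C1 (g ^~ i)) ->
  test_density (fun x i => a * f x i + b * g x i) i z =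
  a * test_density f i z + b * test_density g i z.
Proof.
move=> fC1 gC1; rewrite /test_density coupling_lincomb !torus_grad_pi.
have [_ gE] := C1_lincomb a b (fC1 i) (gC1 i).
rewrite [gradient _ z.1]gE dotDr !dotZr; ring.
Qed.

(** The derivative of [psi] along its own gradient [p] is [dot p p], and it is at most the growth
    rate [K * enorm p] allowed by [v2]. This is why momenta with [|p| <= K] are enough. *)
Lemma gradient_touching_below (psi : torus R d -> R) i (x : 'rV[R]_d) : torus_C1 psi ->
  (forall y, v2 (torus_pi x) i - psi (torus_pi x) <= v2 y i - psi y) ->
  `|gradient (psi \o torus_pi) x| <= K.
Proof.
move=> [dpsi _] xmin; set p := gradient _ _.
rewrite (le_trans (norm_le_enorm _))//.
have : dot p p <= K * enorm p.
  rewrite -derive_dot_gradient; last exact: dpsi.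
  have : derivable (psi \o torus_pi) x p by exact: diff_derivable.
  move=> /cvgrPdist_lt dH; apply/ler_addgt0Pr => e e0.
  have /nbhs_ballP[r /= r0 rP] := dH _ e0.
  pose t := r / 2.
  have t0 : 0 < t by rewrite divr_gt0.
  have tr : ball 0 r t by rewrite /ball/= sub0r normrN gtr0_norm// /t; lra.
  have : 'D_p (psi \o torus_pi) x - e <
      t^-1 *: (((psi \o torus_pi) \o shift x) (t *: p) - (psi \o torus_pi) x).
    by have := rP _ tr (lt0r_neq0 t0); rewrite ltr_distlC => /andP[].
  have : t^-1 *: (((psi \o torus_pi) \o shift x) (t *: p) - (psi \o torus_pi) x) <=
      K * enorm p.
    rewrite -[leLHS]/(t^-1 * _) ler_pdivrMl//=.
    have := xmin (torus_pi (t *: p + x)); have := v2_lip i (t *: p + x) x.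
    rewrite addrK (_ : enorm (t *: p) = t * enorm p); last first.
      by rewrite /enorm dotZl dotZr mulrA -expr2 sqrtrM ?sqr_ge0// sqrtr_sqr gtr0_norm.
    by rewrite ler_norml => /andP[_ ?] ?; lra.
  lra.
rewrite -enorm_sq expr2; have [->|p0] := eqVneq (enorm p) 0.
  by [].
by rewrite ler_pM2r// lt_def p0 enorm_ge0.
Qed.

Lemma no_strict_subsolution s x0 i0 (phi : torus R d -> idx n -> R) k l e :
  s < v1 x0 i0 - v2 x0 i0 -> (forall i, torus_C1 (phi ^~ i)) ->
  0 <= k -> 0 <= l -> 0 < e ->
  ~ (forall i x p, `|p| <= K ->
      test_density phi i (x, p) - k * action_density H i (x, p) +
      l * (v1 (torus_pi x) i - v2 (torus_pi x) i - s) <= - e).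
Proof.
move=> sM phiC1 k0 l0 e0 neg.
have [Lb Lb0 LbP] : exists2 Lb, 0 <= Lb & forall i x p, `|p| <= K ->
    `|action_density H i (x, p)| <= Lb.
  have bnd i : exists M, 0 <= M /\ forall x p, `|p| <= K -> `|action_density H i (x, p)| <= M.
    have [M M0 MP] := periodic_bounded2 (@continuous_action_density R d n H H_C2 i)
      (@periodic_action_density R d n H i) K.
    by exists M.
  have [M MP] := choice bnd.
  exists (\sum_i M i) => [|i x p pK]; first by apply: sumr_ge0 => i _; have [] := MP i.
  have [_ /(_ x p pK)] := MP i => /le_trans; apply.
  by rewrite (bigD1 i)//= lerDl; apply: sumr_ge0 => j _; have [] := MP j.
(* [k] may vanish. Raising it to a positive [k1] costs at most [e / 2] by the bound [Lb], and
   dividing by [k1] normalizes the coefficient of the action to 1. *)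
pose k1 := k + e / (2 * (Lb + 1)).
have Lb1 : 0 < 2 * (Lb + 1) by lra.
have k1k : 0 < k1 - k by rewrite /k1 addrAC subrr add0r divr_gt0.
have k10 : 0 < k1 by lra.
have kLb : (k1 - k) * Lb <= e / 2.
  have : (k1 - k) * (2 * (Lb + 1)) = e by rewrite /k1 addrAC subrr add0r divfK// gt_eqF.
  by nra.
pose e1 := e / (2 * k1).
have e10 : 0 < e1 by rewrite divr_gt0// mulr_gt0.
pose psi x i := k1^-1 * phi x i + 0 * phi x i.
have psiC1 i : torus_C1 (psi ^~ i) by have [] := C1_lincomb k1^-1 0 (phiC1 i) (phiC1 i).
have psi_neg i x p : `|p| <= K -> 0 <= v1 (torus_pi x) i - v2 (torus_pi x) i - s ->
    test_density psi i (x, p) - action_density H i (x, p) <= - e1.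
  move=> pK ws; have := neg i x p pK; have := LbP i x p pK.
  rewrite test_density_lincomb// mul0r addr0 ler_norml => /andP[b1 b2] h.
  rewrite -(ler_pM2l k10) mulrBr mulrA divff ?gt_eqF// mul1r.
  have -> : k1 * - e1 = - (e / 2) by rewrite /e1; field; rewrite gt_eqF.
  have lw : 0 <= l * (v1 (torus_pi x) i - v2 (torus_pi x) i - s) by rewrite mulr_ge0.
  have : - ((k1 - k) * action_density H i (x, p)) <= (k1 - k) * Lb.
    by rewrite -mulrN ler_pM2l//; lra.
  lra.
have cpsi i : continuous (psi ^~ i) by exact: torus_C1_continuous.
have [cv1 _] := v1_sub; have [cv2 v2s] := v2_sup.
have [M M0 MP] : exists2 M, 0 <= M & forall x i, `|psi x i - v1 x i| <= M.
  apply: bounded_torus_idx => i x.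
  by apply: (@continuousB R R^o _ (psi ^~ i) (v1 ^~ i)); [exact: cpsi|exact: cv1].
pose h := v1 x0 i0 - v2 x0 i0 - s.
have h0 : 0 < h by rewrite subr_gt0.
(* A weight of [psi] so small that [Psi] stays within [h / 4] of [v1]. *)
pose t := Num.min (1 / 2) (h / (8 * (M + 1))).
have M1 : 0 < 8 * (M + 1) by lra.
have t0 : 0 < t by rewrite lt_min !divr_gt0.
have t12 : t <= 1 / 2 by rewrite ge_min lexx.
have tM : t * (8 * (M + 1)) <= h by rewrite -ler_pdivlMr// ge_min lexx orbT.
(* The error [r] of the approximate subsolution has to be beaten by the strictness [t * e1]
   contributed by [psi]. *)
pose r := Num.min 1 (Num.min (h / 8) (t * e1 / 2)).
have r0 : 0 < r by rewrite !lt_min ltr01 !divr_gt0// mulr_gt0.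
have [r1 rh rt] : [/\ r <= 1, r <= h / 8 & r <= t * e1 / 2].
  by rewrite /r !ge_min !lexx !orbT.
have [phi1 [phi1C1 phi1v phi1H]] := smooth_subsolution v1_sub r0.
pose Psi x i := (1 - t) * phi1 x i + t * psi x i.
have PsiC1 i : torus_C1 (Psi ^~ i) by have [] := C1_lincomb (1 - t) t (phi1C1 i) (psiC1 i).
have [x [i xmin]] : exists (x : 'rV[R]_d) i, forall y j,
    v2 (torus_pi x) i - Psi (torus_pi x) i <= v2 y j - Psi y j.
  apply: (@min_torus_idx (fun x i => v2 x i - Psi x i)) => i x.
  apply: (@continuousB R R^o _ (v2 ^~ i) (Psi ^~ i)); first exact: cv2.
  exact: torus_C1_continuous.
(* At the minimum point, [v1 - v2] loses at most [h / 2] against its value [s + h] at [(x0, i0)]; so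
   [psi_neg] applies there. *)
have ws : 0 <= v1 (torus_pi x) i - v2 (torus_pi x) i - s.
  have PsiB y j : v1 y j - h / 4 <= Psi y j <= v1 y j + h / 4.
    have := phi1v y j; have := MP y j; rewrite /Psi !ler_norml => /andP[? ?] /andP[? ?].
    have : t * (psi y j - phi1 y j) <= t * (M + 1) by rewrite ler_pM2l//; lra.
    have : t * (- (M + 1)) <= t * (psi y j - phi1 y j) by rewrite ler_pM2l//; lra.
    by move=> ? ?; apply/andP; split; lra.
  have := xmin x0 i0; have /andP[_ ?] := PsiB (torus_pi x) i; have /andP[? _] := PsiB x0 i0.
  have hE : h = v1 x0 i0 - v2 x0 i0 - s by [].
  lra.
pose p := gradient ((Psi ^~ i) \o torus_pi) x.
have pK : `|p| <= K.
  by apply: gradient_touching_below (PsiC1 i) _ => y; exact: xmin.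
have := v2s i (Psi ^~ i) (torus_pi x) (PsiC1 i) (fun y => xmin y i).
rewrite torus_grad_pi -/p => sup.
(* The minimum is taken over points and indices, so it also compares the differences between
   components that enter the coupling. *)
have cPsi : coupling c v2 (torus_pi x) i <= coupling c Psi (torus_pi x) i.
  by apply: ler_sum => j _; rewrite ler_wpM2l//; have := xmin (torus_pi x) j; lra.
have := test_density_lincomb (1 - t) t i (x, p) phi1C1 psiC1.
rewrite {1}/test_density /= -/Psi torus_grad_pi -/p => tE.
have := psi_neg i x p pK ws.
(* The tangent of [H] at [p], evaluated at the slope of [phi1], turns the inequality for [phi1] into
   one for densities at [(x, p)]. There [test_density] is linear in the function, so the
   inequalities for [phi1] and [psi] can be averaged. *)
have := convex_tangent H_C2 H_convex i x p (torus_grad (phi1 ^~ i) (torus_pi x)).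
have := phi1H (torus_pi x) i.
move: tE; rewrite /action_density /test_density /= /lift_H /= dotBr (dotC p).
set q1 := dot _ _; set q2 := dot _ (torus_grad (phi1 ^~ i) _); set q3 := dot _ _.
move: sup cPsi; set hp := H _ p i; set hg := H _ _ i.
set c2 := coupling c v2 _ _; set cP := coupling c Psi _ _; set cp := coupling c psi _ _.
set cf := coupling c phi1 _ _.
move=> sup cPsi tE a1 a2 a3.
have t1 : 0 <= 1 - t by lra.
have := ler_wpM2l t1 (le_trans (_ : q2 + cf - (q1 - hp) <= hg + cf) a1).
have : q2 + cf - (q1 - hp) <= hg + cf by lra.
move=> /[swap] /[apply]; have := ler_wpM2l (ltW t0) a3.
have te1 : 0 < t * e1 by rewrite mulr_gt0.
have tr : 0 <= t * r by rewrite mulr_ge0 ?ltW.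
nra.
Qed.


End comparison.

(** * Mather measures *)

Section phase_space.
Context {R : realType} {d n : nat}.
Notation phase := (torus R d * 'rV[R]_d * idx n)%type.

Lemma borel_phase_open (A : set phase) : open A ->
  measurable (A : set (borel_phase R d n)).
Proof. by move=> oA; exact: sub_sigma_algebra. Qed.

(** Semicontinuity is the right generality for the Lagrangian, a supremum of continuous functions
    that may be infinite. *)
Lemma borel_phase_lsc (f : phase -> \bar R) :
  (forall r : R, open [set z | r%:E < f z]%E) ->
  measurable_fun setT (f : borel_phase R d n -> \bar R).
Proof.
move=> of_; apply: (measurability _ (measurable_realfun.ErealGenOInfty.measurableE R)).
move=> _ [_ [r ->] <-]; rewrite setTI; apply: borel_phase_open.
rewrite (_ : _ @^-1` _ = [set z | r%:E < f z]%E); first exact: of_.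
by apply/seteqP; split=> z /=; rewrite in_itv/= andbT.
Qed.

Lemma continuous_phase (F : idx n -> torus R d * 'rV[R]_d -> R) :
  (forall i, continuous (F i)) -> continuous (fun z : phase => F z.2 z.1).
Proof.
move=> cF [a i]; apply: (@cvg_trans _ ((fun z : phase => F i z.1) @ (nbhs (a, i)))).
  apply: near_eq_cvg; near=> z.
  have -> : z.2 = i.
    near: z; exists (setT, [set i]) => /=; last by case=> x j [_ ->].
    by split; [exact: filterT|exact: discrete_set1].
  by [].
apply: (@continuous_comp _ _ _ fst (F i)); first exact: cvg_fst.
exact: cF.
Unshelve. all: by end_near. Qed.

Lemma borel_phase_continuous (f : phase -> R) : continuous f ->
  measurable_fun setT ((fun z => (f z)%:E) : borel_phase R d n -> \bar R).
Proof.
move=> /continuousP cf; apply: borel_phase_lsc => r.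
rewrite (_ : [set _ | _] = f @^-1` [set x | r < x]).
  by apply: cf; exact: open_gt.
by apply/seteqP; split => z /=; rewrite lte_fin.
Qed.

Lemma hausdorff_separated (T : topologicalType) :
  (forall x y : T, x != y -> exists2 f : T -> R, continuous f & f x != f y) ->
  hausdorff_space T.
Proof.
move=> sep x y xy; apply/eqP; apply: contrapT => /negP nxy.
have [f cf /eqP] := sep x y nxy; apply.
apply: (@Rhausdorff R) => A B /cf xA /cf yB.
have [z [/= zA zB]] := xy _ _ xA yB.
by exists (f z).
Qed.

Lemma penalty_eq0 (x y : 'rV[R]_d) : 0 = penalty x y -> torus_pi x = torus_pi y.
Proof.
move=> pxy; apply/torus_piP => k; apply: contrapT => nk.
set w := x 0 k - y 0 k in nk.
have /andP[w1 w2] := floor_itv w; rewrite intrD in w2.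
have {}w1 : (Num.floor w)%:~R < w.
  rewrite lt_neqAle w1 andbT; apply/eqP => wE.
  by apply: nk; rewrite -wE intr_int.
(* The distance from the non-integer [w] to the integers; a zero penalty would give an integer
   closer than that. *)
pose r := Num.min (w - (Num.floor w)%:~R) ((Num.floor w)%:~R + 1 - w).
have r0 : 0 < r by rewrite lt_min !subr_gt0 w1 w2.
have [e e0 small] := @small_penalty R d r r0.
have [z zy zx] := small x y ltac:(by rewrite -pxy ltW).
have /torus_piP/(_ k)/intrP[m zm] := zy.
have : `|w - m%:~R| < r.
  rewrite -zm distrC /w (_ : _ - _ - _ = (z - x) 0 k); last by rewrite !mxE; ring.
  exact: le_lt_trans (coord_le_norm _ _) zx.
rewrite lt_min => /andP[/ltr_normlP[l1 l2] /ltr_normlP[l3 l4]].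
have [mf|fm] := leP m (Num.floor w).
  have : m%:~R <= (Num.floor w)%:~R :> R by rewrite ler_int.
  lra.
have : (Num.floor w)%:~R + 1 <= m%:~R :> R.
  by rewrite -[1]/(1%:~R) -intrD ler_int lezD1.
lra.
Qed.

(** Separation makes compact sets closed, hence Borel. The penalty separates positions, and the
    coordinates separate velocities. *)
Lemma hausdorff_phase : hausdorff_space phase.
Proof.
apply: hausdorff_separated => -[[a p] i] [[b q] j].
rewrite !xpair_eqE !negb_and -orbA => /or3P[ab|pq|ij].
- pose u := (penalty (repr a)) \o (@repr _ (torus R d)).
  have uE : u \o torus_pi = penalty (repr a).
    exact: periodic_descend (penalty_periodic (repr a)).
  have cu : continuous u.
    by apply/torus_continuousP; rewrite uE; exact: (C1_continuous (penalty_C1 _).1).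
  exists (fun z : phase => u z.1.1).
    apply: (@continuous_phase (fun _ y => u y.1)) => k y.
    by apply: (@continuous_comp _ _ _ fst u); [exact: cvg_fst|exact: cu].
  rewrite /= /u /= penalty_diag eq_sym; apply/eqP => p0.
  move/eqP : ab; apply; rewrite -(torus_piK a) -(torus_piK b).
  exact: penalty_eq0.
- have /existsP[k pk] : [exists k, p 0 k != q 0 k].
    apply: contrapT => /negP; rewrite negb_exists => /forallP pq'.
    move/eqP : pq; apply; apply/rowP => k; apply/eqP.
    by have := pq' k; rewrite negbK.
  exists (fun z : phase => z.1.2 0 k) => //.
  apply: (@continuous_phase (fun _ y => y.2 0 k)) => l y.
  apply: (@continuous_comp _ _ _ snd (fun v : 'rV[R]_d => v 0 k)); first exact: cvg_snd.
  exact: coord_continuous.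
- exists (fun z : phase => (z.2 == i)%:R : R).
    by apply: (@continuous_phase (fun k y => (k == i)%:R : R)) => k y; exact: cvg_cst.
  have /negbTE ji : j != i by rewrite eq_sym.
  by rewrite /= eqxx ji oner_neq0.
Qed.

Lemma borel_phase_compact (K : set phase) : compact K ->
  measurable (K : set (borel_phase R d n)).
Proof.
move=> /(compact_closed hausdorff_phase) cK.
rewrite -[K]setCK; apply: measurableC; apply: borel_phase_open.
exact: closed_openC.
Qed.

Variables (H : torus R d -> 'rV[R]_d -> idx n -> R).
Hypotheses (H_C2 : hamiltonian_C2 H).

Lemma continuous_H_torus p i : continuous (fun x => H x p i).
Proof.
apply/torus_continuousP => x.
apply: (@continuous_comp _ _ _ (fun x : 'rV[R]_d => (x, p)) (lift_H H i)).
  exact: (cvg_pair (@cvg_id _ (nbhs x)) (@cst_continuous _ _ p x)).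
exact: continuous_lift_H.
Qed.

Lemma measurable_lagrangian :
  measurable_fun setT ((fun z => lagrangian H z.1.1 z.1.2 z.2) : borel_phase R d n -> \bar R).
Proof.
apply: borel_phase_lsc => r.
rewrite (_ : [set z | _] = \bigcup_p [set z : phase | r < dot p z.1.2 - H z.1.1 p z.2]).
  apply: bigcup_open => p _.
  have : continuous (fun z : phase => dot p z.1.2 - H z.1.1 p z.2).
    apply: (@continuous_phase (fun i y => dot p y.2 - H y.1 p i)) => i y.
    apply: (@continuousB R R^o _ (fun y => dot p y.2) (fun y => H y.1 p i)).
      by apply: (@continuous_comp _ _ _ snd (dot p)); [exact: cvg_snd|exact: continuous_dotr].
    apply: (@continuous_comp _ _ _ fst (fun x => H x p i)); first exact: cvg_fst.
    exact: continuous_H_torus.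
  by move=> /continuousP/(_ [set x | r < x]); apply; exact: open_gt.
apply/seteqP; split=> z /=.
  by move=> /ereal_sup_gt[_ [p _ <-]]; rewrite lte_fin => ?; exists p.
move=> [p _ /= rp]; rewrite (@lt_le_trans _ _ (dot p z.1.2 - H z.1.1 p z.2)%:E)%E//.
by apply: ereal_sup_ubound; exists p.
Qed.

End phase_space.

(* The compact space of all [(x, p, i)] with [|p| <= K] is coded by the real
   set [codes]: the index [i] selects the interval [2 i, 2 i + 1], on which the
   space-filling curve gives [x] and [p]. *)
Section codes.
Context {R : realType} {d n : nat} (K : R).
Hypothesis K0 : 0 <= K.

Definition code_pos t : 'rV[R]_d := \row_k curve (d + d) k t.

(** The factor uses [K + 1] rather than [K] because surjectivity of the curve is only available for
    values in [[0, 1)]; it also stays positive when [K = 0]. *)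
Definition code_mom t : 'rV[R]_d :=
  \row_k (2 * (K + 1) * (curve (d + d) (d + k) t - 1 / 2)).

Definition code_point t := (code_pos t, code_mom t).

(** Nondecreasing on the whole line, hence measurable; [minn] keeps the argument of [inord] in
    range. *)
Definition code_idx (t : R) : idx n := inord (minn (Num.truncn (t / 2)) n).

Definition codes : set R :=
  [set t | exists i : idx n, 2 * (i : nat)%:R <= t <= 2 * (i : nat)%:R + 1].

Lemma continuous_code_point : continuous code_point.
Proof.
have cx : continuous code_pos.
  apply: continuous_row => k; rewrite (_ : (fun t => _) = curve (d + d) k).
    exact: continuous_curve.
  by apply/funext => t; rewrite mxE.
have cp : continuous code_mom.
  apply: continuous_row => k.
  rewrite (_ : (fun t => _) = (fun t => 2 * (K + 1) * (curve (d + d) (d + k) t - 1 / 2))).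
    apply: continuous_scale => t.
    apply: (@continuousB R R^o _ (curve (d + d) (d + k)) (fun=> 1 / 2)).
      exact: continuous_curve.
    exact: cvg_cst.
  by apply/funext => t; rewrite mxE.
by move=> t; exact: (cvg_pair (cx t) (cp t)).
Qed.

Lemma code_idxE (i : idx n) t :
  2 * (i : nat)%:R <= t -> t < 2 * (i : nat)%:R + 2 -> code_idx t = i.
Proof.
move=> it ti; apply: val_inj; rewrite /code_idx /=.
have -> : Num.truncn (t / 2) = i.
  by apply: truncn_def; rewrite -[X in _ < X]natr1; apply/andP; split; lra.
have ilen : ((i : 'I_n.+1) <= n)%N by rewrite -ltnS ltn_ord.
by rewrite (minn_idPl ilen) inordK.
Qed.

Lemma codes_idx t : codes t -> 2 * (code_idx t : nat)%:R <= t <= 2 * (code_idx t : nat)%:R + 1.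
Proof. by move=> [i /andP[it ti]]; rewrite (@code_idxE i)//; [rewrite it|lra]. Qed.

(** Intervals of different indices are separated by gaps of length at least 1. *)
Lemma codes_near s t : codes s -> codes t -> `|s - t| < 1 -> code_idx s = code_idx t.
Proof.
move=> /codes_idx; move: (code_idx s) => i /andP[s1 s2].
move=> [j /andP[t1 t2]]; rewrite (@code_idxE j t)//; last lra.
rewrite ltr_norml => /andP[st ts]; apply/eqP.
have ij : (i : nat)%:R < (j : nat)%:R + 1 :> R by lra.
have ji : (j : nat)%:R < (i : nat)%:R + 1 :> R by lra.
move: ij ji; rewrite !natr1 !ltr_nat !ltnS => ij ji.
by rewrite -val_eqE /= eqn_leq ij ji.
Qed.

Lemma codes_nonempty : codes !=set0.
Proof. by exists 0; exists (ord0 : 'I_n.+1) => /=; rewrite mulr0 add0r lexx ler01. Qed.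

Lemma compact_codes : compact codes.
Proof.
rewrite (_ : codes = \big[setU/set0]_(i <- enum 'I_n.+1)
    `[2 * (i : nat)%:R, 2 * (i : nat)%:R + 1]%classic).
  elim/big_ind : _ => [||i _]; [exact: compact0|exact: compactU|].
  exact: segment_compact.
rewrite -bigcup_seq; apply/seteqP; split=> t.
  by move=> [i ti]; exists i; rewrite /= ?mem_enum// in_itv.
by move=> [i _ /=]; rewrite in_itv/= => ti; exists i.
Qed.

Lemma codes_surjective (i : idx n) (x p : 'rV[R]_d) :
  (forall k, 0 <= x 0 k < 1) -> `|p| <= K ->
  exists t, [/\ codes t, code_idx t = i & code_point t = (x, p)].
Proof.
move=> x01 pK.
have K1 : 0 < 2 * (K + 1) by rewrite mulr_gt0 ?ltr_wpDl.
pose y (j : nat) : R :=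
  if insub j is Some k then x 0 (k : 'I_d) else
  if insub (j - d)%N is Some k then p 0 (k : 'I_d) / (2 * (K + 1)) + 1 / 2 else 0.
have y01 j : 0 <= y j < 1.
  rewrite /y; case: insubP => [k _ _|_]; first exact: x01.
  case: insubP => [k _ _|_]; last by rewrite lexx ltr01.
  have := le_trans (coord_le_norm p k) pK; rewrite ler_norml => /andP[p1 p2].
  have q1 : - 1 / 2 < p 0 k / (2 * (K + 1)) by rewrite ltr_pdivlMr//; lra.
  have q2 : p 0 k / (2 * (K + 1)) < 1 / 2 by rewrite ltr_pdivrMr//; lra.
  by apply/andP; split; lra.
have [t /andP[t0 t1] ty] := curve_surjective (d + d) y01.
have tE j : (j < d + d)%N -> curve (d + d) j (t + 2 * (i : nat)%:R) = y j.
  by move=> jd; rewrite curve_periodic ty.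
exists (t + 2 * (i : nat)%:R); split.
- by exists i; apply/andP; split; lra.
- by apply: code_idxE; lra.
- congr pair; apply/rowP => k; rewrite mxE tE.
  + by rewrite /y insubT// => kd; congr (x 0 _); exact: val_inj.
  + by rewrite ltn_addl.
  + rewrite /y insubF ?ltnNge ?leq_addr//= addKn insubT//= => kd.
    rewrite addrK mulrC divfK ?gt_eqF//; congr (p 0 _); exact: val_inj.
  + by rewrite ltn_add2l.
Qed.

Lemma measurable_code_idx (i : idx n) : measurable [set t | code_idx t = i].
Proof.
pose m (t : R) : R := (code_idx t : nat)%:R.
have m_nd : nondecreasing_fun m.
  move=> s t st; rewrite /m /code_idx ler_nat.
  rewrite !inordK ?ltnS ?geq_minr// leq_min geq_minr andbT.
  rewrite (leq_trans (geq_minl _ _))//; apply: le_truncn.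
  by rewrite ler_pM2r// invr_gt0.
have := nondecreasing_measurable measurableT m_nd.
move=> /(_ measurableT _ (measurable_set1 ((i : nat)%:R : R))).
rewrite setTI; congr measurable; apply/seteqP; split=> t /=.
  by move=> /eqP; rewrite eqr_nat => /eqP; exact: val_inj.
by rewrite /m => ->.
Qed.

Definition piecewise (G : idx n -> 'rV[R]_d * 'rV[R]_d -> R) (t : R) :=
  G (code_idx t) (code_point t).

Variable G : idx n -> 'rV[R]_d * 'rV[R]_d -> R.
Hypothesis cG : forall i, continuous (G i).

Let cGc i : continuous (G i \o code_point).
Proof.
by move=> t; apply: continuous_comp; [exact: continuous_code_point|exact: cG].
Qed.

Lemma piecewise_bounded : bounded_on codes (piecewise G).
Proof.
have bnd i : exists M, forall t, codes t -> `|G i (code_point t)| <= M.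
  have [M [_ GM]] := compact_bounded (continuous_compact
    (continuous_subspaceT (@cGc i)) compact_codes).
  exists (`|M| + 1) => t ct; apply: GM; first by rewrite ltr_pwDr// ler_norm.
  by exists t.
have [M MP] := choice bnd.
exists (\sum_i `|M i|) => t ct.
rewrite (le_trans (MP (code_idx t) t ct))// (bigD1 (code_idx t))//=.
by rewrite (le_trans (ler_norm _))// lerDl; exact: sumr_ge0.
Qed.

Lemma piecewise_uniform e : 0 < e -> exists2 r, 0 < r &
  forall s t, codes s -> codes t -> `|s - t| < r ->
    `|piecewise G s - piecewise G t| <= e.
Proof.
move=> e0.
have unif i : exists r, 0 < r /\ forall s t, codes s -> `|s - t| < r ->
    `|G i (code_point s) - G i (code_point t)| <= e.
  have [r r0 rP] := @compact_uniform R R^o _ _ (@cGc i) compact_codes e e0.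
  by exists r.
have [r rP] := choice unif.
pose r0 := r [arg min_(j < (ord0 : idx n)) r j]%O.
have r00 : 0 < r0 by have [] := rP [arg min_(j < (ord0 : idx n)) r j]%O.
have r0r i : r0 <= r i by rewrite /r0; case: arg_minP => // j _; exact.
exists (Num.min 1 r0) => [|s t cs ct]; first by rewrite lt_min ltr01.
rewrite lt_min => /andP[st1 str]; rewrite /piecewise (codes_near cs ct st1).
have [_] := rP (code_idx t); apply => //; exact: lt_le_trans (r0r _).
Qed.

End codes.

(** * The Radon measure represented by a functional on codes *)

Section coded_measure.
Context {R : realType} {d n : nat}.
Variables (G : idx n -> R -> torus R d * 'rV[R]_d).
Hypothesis cG : forall i, continuous (G i).
Variable L : (R -> R) -> R.
Let E := @codes R n.
Hypotheses
  (LD : forall f g, bounded_on E f -> bounded_on E g ->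
     L (fun t => f t + g t) = L f + L g)
  (LZ : forall a f, bounded_on E f -> L (fun t => a * f t) = a * L f)
  (L_le : forall f c, bounded_on E f -> (forall t, E t -> f t <= c) -> L f <= c).

Notation phase := (torus R d * 'rV[R]_d * idx n)%type.

Let E0 : E !=set0 := @codes_nonempty R n.
Let cE : compact E := @compact_codes R n.

Let Q := quantile E L.

Let Q_codes u : E (Q u). Proof. exact: quantile_mem. Qed.

Definition decode (t : R) : borel_phase R d n := (G (code_idx t) t, code_idx t).

Let cGi i : continuous (fun t => (G i t, i) : phase).
Proof.
by move=> t; exact: (cvg_pair (@cG i t) (@cst_continuous _ _ i t)).
Qed.

Let X (u : R) : borel_phase R d n := decode (Q u).

Let mQ : measurable_fun setT Q.
Proof. exact: measurable_quantile. Qed.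

Let mX : measurable_fun setT X.
Proof.
apply: (measurability _
  (erefl : @measurable _ (borel_phase R d n) = <<s (@open phase) >>)) => _ [U oU <-].
rewrite setTI.
rewrite (_ : _ @^-1` _ = \bigcup_(i in [set: idx n])
    (Q @^-1` ([set t | code_idx t = i] `&` [set t | U (G i t, i)]))); last first.
  by apply/seteqP; split=> [u XU|u [i _ [/= ui]]];
    [exists (code_idx (Q u))|rewrite /X /decode ui].
apply: fin_bigcup_measurable => // i _.
rewrite -[X in measurable X]setTI; apply: mQ => //.
apply: measurableI; first exact: measurable_code_idx.
apply: open_measurable.
by have /continuousP := @cGi i; apply.
Qed.

Let P : probability (measurableTypeR R) R := uniform_prob (@ltr01 R).

Let uniformE (U : set R) : measurable U ->
  P U = lebesgue_measure (U `&` `[0, 1]%classic).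
Proof.
move=> mU; rewrite /P /= /uniform_prob integral_uniform_pdf.
rewrite (eq_integral (fun=> 1%E)); last first.
  move=> x /[!inE] -[_ /=]; rewrite in_itv/= /uniform_pdf => ->.
  by rewrite subr0 invr1.
rewrite integral_cst ?mul1e//; exact: measurableI.
Qed.

Let mX' : @measurable_fun _ _ (measurableTypeR R) (borel_phase R d n) setT X.
Proof. exact: mX. Qed.

(** The law of the decoded quantile at a uniformly distributed level. *)
Definition coded_measure : probability (borel_phase R d n) R :=
  distribution P (@mfun_Sub _ _ (measurableTypeR R) (borel_phase R d n) X (mem_set mX')).

Lemma coded_measureE A : coded_measure A = P (X @^-1` A).
Proof. by []. Qed.

(** A change of variables to the uniform law, followed by the quantile representation of [L]. *)
Lemma coded_integral (g : borel_phase R d n -> \bar R) (h : R -> R) :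
  measurable_fun setT g -> (forall t, g (decode t) = (h t)%:E) ->
  bounded_on E h ->
  (forall e, 0 < e -> exists2 r, 0 < r &
     forall s t, E s -> E t -> `|s - t| < r -> `|h s - h t| <= e) ->
  coded_measure.-integrable setT g /\ (\int[coded_measure]_z g z = (L h)%:E)%E.
Proof.
move=> mg gh bh uh; have gXE : g \o X = EFin \o (h \o Q).
  by apply/funext => u; rewrite /= /X gh.
have mhQ : measurable_fun setT (h \o Q).
  by apply/measurable_EFinP; rewrite -gXE; exact: measurableT_comp.
have [M hM] := bh.
have bhQ (A : set R) : [bounded (h \o Q) u | u in A].
  exists M; split=> [|r Mr u _ /=]; first exact: num_real.
  by rewrite (le_trans (hM _ (Q_codes u)))// ltW.
have iX : P.-integrable setT (g \o X).
  rewrite gXE; apply: measurable_bounded_integrable => //.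
  by apply: (eq_ind_r (fun z => z < +oo)%E _ (@probability_setT _ _ _ P)); exact: ltry.
split.
  exact: (@integrable_pushforward _ _ (measurableTypeR R) (borel_phase R d n) R
    X mX' P setT g mg iX measurableT).
rewrite /coded_measure integral_distribution// -/X.
rewrite (_ : (g \o _) = EFin \o (h \o Q))//.
have intU (f : measurableTypeR R -> \bar R) : measurable_fun setT f ->
    (forall x, 0 <= f x)%E ->
    (\int[P]_x f x = \int[lebesgue_measure]_(x in `[0%R, 1%R]) f x)%E.
  move=> mf f0; rewrite /P integral_uniform// subr0 invr1 mul1e.
  by [].
have mE : measurable_fun setT (EFin \o (h \o Q)) by exact/measurable_EFinP.
rewrite integralE !intU//; last 2 first.
  exact: measurable_funeneg.
  exact: measurable_funepos.
rewrite -integralE -integral_itv_obnd_cbnd; last exact: measurable_funTS.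
rewrite (functional_quantile E0 cE LD LZ L_le bh uh mhQ) /Rintegral fineK//.
apply: integrable_fin_num => //; apply: measurable_bounded_integrable => //.
  by rewrite /= lebesgue_measure_itv/= lte_fin ltr01 -EFinB ltry.
exact: measurable_funTS.
Qed.

(** Lusin's theorem gives a compact [V] of almost full measure on which the quantile is continuous.
    A compact [W] inside [V] and the preimage of [A] then has a compact image that carries almost
    all the mass of [A]. *)
Lemma radon_coded_measure : radon coded_measure.
Proof.
move=> A mA; apply/eqP; rewrite eq_le; apply/andP; split; last first.
  apply: ge_ereal_sup => _ [B [cB BA] <-].
  by apply: le_measure; rewrite ?inE//; exact: borel_phase_compact.
apply/lee_addgt0Pr => e e0.
pose I : set R := `[0, 1]%classic.
have mI : measurable I by exact: measurable_itv.
have mXA : measurable (X @^-1` A : set R) by rewrite -[_ @^-1` _]setTI; exact: mX.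
have e2 : 0 < e / 2 by rewrite divr_gt0.
have I01 : (@lebesgue_measure R I < +oo)%E.
  by rewrite /= lebesgue_measure_itv/= lte_fin ltr01 -EFinB ltry.
have [V [cV V01 Ve cQ]] := measurable_almost_continuous mI I01 e2
  (measurable_funTS mQ).
have mV : measurable V by exact: compact_measurable.
have mXV : measurable (X @^-1` A `&` V : set R) by exact: measurableI.
have XVoo : (@lebesgue_measure R (X @^-1` A `&` V) < +oo)%E.
  apply: le_lt_trans I01; apply: le_measure; rewrite ?inE//.
  by move=> u [_ /V01].
have [W [cW WV We]] := lebesgue_regularity_inner mXV XVoo e2.
have cQW : compact (Q @` W).
  apply: continuous_compact => //; apply: continuous_subspaceW cQ.
  by move=> u /WV[].
pose B := X @` W.
have cB : compact (B : set phase).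
  (* Decoding is continuous on each interval of codes, so the image is cut into finitely many
     compact pieces, one for each index. *)
  rewrite (_ : B = \big[setU/set0]_(i <- enum 'I_n.+1)
    ((fun t => (G i t, i) : phase) @`
      (Q @` W `&` `[2 * (i : nat)%:R, 2 * (i : nat)%:R + 1]%classic))).
    elim/big_ind : _ => [||i _]; [exact: compact0|exact: compactU|].
    apply: continuous_compact; first exact: (continuous_subspaceT (@cGi i)).
    apply: compact_closedI => //; exact: interval_closed.
  rewrite -bigcup_seq; apply/seteqP; split=> z.
    move=> [u Wu <-]; exists (code_idx (Q u)); first by rewrite /= mem_enum.
    exists (Q u) => //; split; first by exists u.
    by rewrite /= in_itv/=; exact: codes_idx (Q_codes u).
  move=> [i _ [_ [[u Wu <-] /=]]]; rewrite in_itv/= => /andP[iQ Qi] <-.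
  exists u => //; rewrite /X /decode (@code_idxE _ _ i)//.
  by rewrite (le_lt_trans Qi)// ltrD2l ltr1n.
have BA : B `<=` A by move=> _ [u /WV[Au _] <-].
have mW : measurable W by exact: compact_measurable.
have mB : measurable (B : set (borel_phase R d n)) by exact: borel_phase_compact.
have mXB : measurable (X @^-1` B : set R) by rewrite -[_ @^-1` _]setTI; exact: mX.
apply: (@le_trans _ _ (coded_measure B + e%:E)%E); last first.
  by rewrite leeD2r//; apply: ereal_sup_ubound; exists B.
rewrite !coded_measureE !uniformE// -/I.
have WI : W `<=` I by move=> u /WV[_ /V01].
have m1 : measurable ((X @^-1` A `&` V) `\` W : set R) by exact: measurableD.
have m2 : measurable (I `\` V) by exact: measurableD.
have m12 := measurableU _ _ m1 m2.
apply: (@le_trans _ _ (lebesgue_measure (W `|` (((X @^-1` A `&` V) `\` W) `|` (I `\` V))))).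
  apply: le_measure; rewrite ?inE; [exact: measurableI|exact: measurableU|].
  move=> u [Au u01]; have [Wu|NWu] := pselect (W u); first by left.
  right; have [Vu|NVu] := pselect (V u); first by left.
  by right.
apply: (le_trans (@measureU2 _ _ R lebesgue_measure _ _ mW m12)).
apply: leeD.
  apply: le_measure; rewrite ?inE//; first exact: measurableI.
  by move=> u Wu; split; [exists u|exact: WI].
apply: (le_trans (@measureU2 _ _ R lebesgue_measure _ _ m1 m2)).
by rewrite [e]splitr EFinD leeD// ltW.
Qed.

End coded_measure.

(** * Closed measures: the lower bound on the action and the construction by duality *)

Section mather_measure_existence.
Context {R : realType} {d n : nat}.
Variables (H : torus R d -> 'rV[R]_d -> idx n -> R) (c : idx n -> idx n -> R).
Hypotheses (c_ge0 : forall i j, 0 <= c i j) (H_C2 : hamiltonian_C2 H)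
  (H_convex : forall x i,
     convex_function [set: convex_lmodType 'rV[R]_d] (fun p => H x p i))
  (H_superlinear : unif_coercive (fun x p i => H x p i / enorm p)).

Notation phase := (torus R d * 'rV[R]_d * idx n)%type.

(** The tangent inequality says that [p] attains the supremum defining the Lagrangian at its own
    velocity. *)
Lemma lagrangian_velocity i x p :
  lagrangian H (torus_pi x) (velocity H i (x, p)) i = (action_density H i (x, p))%:E.
Proof.
apply/eqP; rewrite eq_le; apply/andP; split; last by apply: ereal_sup_ubound; exists p.
apply: ge_ereal_sup => _ [q _ <-]; rewrite lee_fin /action_density /=.
have := convex_tangent H_C2 H_convex i x p q.
by rewrite /lift_H /= dotBr (dotC p) (dotC q); lra.
Qed.

Lemma continuous_torus_grad (u : torus R d -> R) : torus_C1 u -> continuous (torus_grad u).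
Proof.
move=> uC1; apply/torus_continuousP.
rewrite (_ : _ \o _ = gradient (u \o torus_pi)); first exact: continuous_gradient.
by apply/funext => x /=; rewrite torus_grad_pi.
Qed.

Lemma continuous_test phi : (forall i, torus_C1 (phi ^~ i)) -> forall i,
  continuous (fun y : torus R d * 'rV[R]_d =>
    dot y.2 (torus_grad (phi ^~ i) y.1) + coupling c phi y.1 i).
Proof.
move=> phiC1 i y.
apply: (@continuousD R R^o _ (fun y => dot y.2 (torus_grad (phi ^~ i) y.1))
  (fun y => coupling c phi y.1 i)).
  apply: continuous_dot => z; first exact: cvg_snd.
  apply: (@continuous_comp _ _ _ fst (torus_grad (phi ^~ i))); first exact: cvg_fst.
  exact: continuous_torus_grad.
apply: (@continuous_comp _ _ _ fst (fun x => coupling c phi x i)); first exact: cvg_fst.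
by apply: continuous_coupling => j; exact: torus_C1_continuous.
Qed.

Lemma continuous_test_density phi : (forall i, torus_C1 (phi ^~ i)) -> forall i,
  continuous (test_density H c phi i).
Proof.
move=> phiC1 i z.
apply: (@continuous_comp _ _ _ (fun z : 'rV[R]_d * 'rV[R]_d => (torus_pi z.1, velocity H i z))
  (fun y => dot y.2 (torus_grad (phi ^~ i) y.1) + coupling c phi y.1 i)).
  have c1 : continuous (fun z : 'rV[R]_d * 'rV[R]_d => torus_pi z.1).
    move=> y; apply: (@continuous_comp _ _ _ fst torus_pi); first exact: cvg_fst.
    exact: continuous_torus_pi.
  exact: (cvg_pair (c1 z) (@continuous_velocity R d n H H_C2 i z)).
exact: continuous_test.
Qed.

(** Taking the slope of a smooth approximate subsolution in the supremum shows that the Lagrangian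
    is at least the closedness integrand minus [e], which integrates to [- e]. *)
Lemma mather_action_ge0 v (nu : probability (borel_phase R d n) R) :
  viscosity_subsolution H c v -> closed_measure c nu -> (0 <= mather_action H nu)%E.
Proof.
move=> v_sub [_ nu_closed]; apply/lee_addgt0Pr => e e0.
have [phi [phiC1 _ phiH]] := smooth_subsolution c_ge0 H_C2 H_convex H_superlinear v_sub e0.
have [] := nu_closed phi phiC1; set g := (fun z => _) => ig g0.
have ie : nu.-integrable setT (fun=> e%:E).
  by apply: finite_measure_integrable_cst.
have gL z : (g z - e%:E <= lagrangian H z.1.1 z.1.2 z.2)%E.
  rewrite /g -EFinB; set q := torus_grad (phi ^~ z.2) z.1.1.
  apply: (@le_trans _ _ (dot q z.1.2 - H z.1.1 q z.2)%:E); last first.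
    by apply: ereal_sup_ubound; exists q.
  by rewrite lee_fin dotC; have := phiH z.1.1 z.2; rewrite -/q; lra.
have ige : nu.-integrable setT (fun z => g z - e%:E)%E by exact: integrableB.
have : (\int[nu]_z (g z - e%:E) = - e%:E)%E.
  rewrite integralB// g0 integral_cst//.
  by rewrite [X in (_ * X)%E](_ : _ = 1%E) ?mule1 ?sub0e//; exact: probability_setT.
move=> gE; rewrite -leeBlDr// sub0e -gE /mather_action.
have mL := measurable_lagrangian H_C2.
(* The Lagrangian need not be integrable, so positive and negative parts are compared separately. *)
rewrite [leLHS]integralE [leRHS]integralE leeB//.
- apply: ge0_le_integral => //.
  + by move/integrableP : ige => [+ _]; exact: measurable_funepos.
  + exact: measurable_funepos.
  + by move=> z /mem_set; apply: funepos_le => y _; exact: gL.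
- apply: ge0_le_integral => //.
  + exact: measurable_funeneg.
  + by move/integrableP : ige => [+ _]; exact: measurable_funeneg.
  + by move=> z /mem_set; apply: funeneg_le => y _; exact: gL.
Qed.

Variables v1 v2 : torus R d -> idx n -> R.
Variable K : R.
Hypotheses (K0 : 0 <= K) (v1_sub : viscosity_subsolution H c v1)
  (v2_sup : viscosity_supersolution H c v2)
  (v2_lip : forall i x y, `|v2 (torus_pi x) i - v2 (torus_pi y) i| <= K * enorm (x - y)).

(* A functional that is nonnegative on these densities vanishes on every
   [test_density phi], is nonpositive on [action_density], and is at least [s]
   on [v1 - v2]. *)
Definition cone_density s phi k l i (z : 'rV[R]_d * 'rV[R]_d) :=
  test_density H c phi i z - k * action_density H i z +
  l * (v1 (torus_pi z.1) i - v2 (torus_pi z.1) i - s).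

Definition density_cone s : set (R -> R) :=
  [set h | exists phi k l, [/\ forall i, torus_C1 (phi ^~ i), 0 <= k, 0 <= l &
    h = piecewise K (cone_density s phi k l)]].

Lemma continuous_value (v : torus R d -> idx n -> R) i : continuous (v ^~ i) ->
  continuous (fun z : 'rV[R]_d * 'rV[R]_d => v (torus_pi z.1) i : R).
Proof.
move=> /continuous_comp_pi cv z.
by apply: (@continuous_comp _ _ _ fst ((v ^~ i) \o torus_pi)); [exact: cvg_fst|exact: cv].
Qed.

Let cv1 i : continuous (v1 ^~ i). Proof. by case: v1_sub. Qed.
Let cv2 i : continuous (v2 ^~ i). Proof. by case: v2_sup. Qed.

Lemma continuous_cone_density s phi k l : (forall i, torus_C1 (phi ^~ i)) ->
  forall i, continuous (cone_density s phi k l i).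
Proof.
move=> phiC1 i z.
apply: (@continuousD R R^o _ (fun z => test_density H c phi i z - k * action_density H i z)
  (fun z => l * (v1 (torus_pi z.1) i - v2 (torus_pi z.1) i - s))).
  apply: (@continuousB R R^o _ (test_density H c phi i) (fun z => k * action_density H i z)).
    exact: continuous_test_density.
  by apply: continuous_scale; exact: continuous_action_density.
apply: continuous_scale => {}z.
apply: (@continuousB R R^o _ (fun z => v1 (torus_pi z.1) i - v2 (torus_pi z.1) i) (fun=> s)).
  apply: (@continuousB R R^o _ (fun z => v1 (torus_pi z.1) i) (fun z => v2 (torus_pi z.1) i)).
    exact: continuous_value (@cv1 i) z.
  exact: continuous_value (@cv2 i) z.
exact: cvg_cst.
Qed.

(** Up to periodicity, codes reach every position and every momentum with [|p| <= K], so strict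
    negativity on codes is the situation excluded by [no_strict_subsolution]. *)
Lemma nonneg_density_cone s x0 i0 : s < v1 x0 i0 - v2 x0 i0 ->
  nonneg_cone (@codes R n) (density_cone s).
Proof.
move=> sM; split.
- move=> _ [phi [k [l [phiC1 _ _ ->]]]].
  exact: piecewise_bounded (@continuous_cone_density s phi k l phiC1).
- move=> _ _ [phi [k [l [phiC1 k0 l0 ->]]]] [phi' [k' [l' [phiC1' k'0 l'0 ->]]]].
  exists (fun x i => 1 * phi x i + 1 * phi' x i), (k + k'), (l + l').
  split; [|exact: addr_ge0|exact: addr_ge0|].
    by move=> i; have [] := C1_lincomb 1 1 (phiC1 i) (phiC1' i).
  apply/funext => t; rewrite /piecewise /cone_density test_density_lincomb//; ring.
- move=> a _ a0 [phi [k [l [phiC1 k0 l0 ->]]]].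
  exists (fun x i => a * phi x i + 0 * phi x i), (a * k), (a * l).
  split; [|exact: mulr_ge0|exact: mulr_ge0|].
    by move=> i; have [] := C1_lincomb a 0 (phiC1 i) (phiC1 i).
  apply/funext => t; rewrite /piecewise /cone_density test_density_lincomb//; ring.
- move=> _ [phi [k [l [phiC1 k0 l0 ->]]]] [e e0 neg].
  apply: (no_strict_subsolution c_ge0 H_C2 H_convex H_superlinear K0 v1_sub v2_sup
    v2_lip sM phiC1 k0 l0 e0) => i x p pK.
  have [m [pm x01]] := lattice_shift x.
  have [t [ct ti tE]] := codes_surjective K0 i x01 pK.
  have := neg t ct; rewrite /piecewise ti tE.
  rewrite /cone_density /test_density /action_density /=.
  by rewrite (velocity_periodic H i p (pm x)) (periodic_lift_H H i p (pm x)) pm.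
Qed.

(** The measure charges only velocities of bounded momenta, where the Lagrangian is the continuous
    [action_density]. The reals [r1] and [r2] record that both integrals are finite and can be
    subtracted. *)
Lemma near_mather_measure s x0 i0 : s < v1 x0 i0 - v2 x0 i0 ->
  exists mu : probability (borel_phase R d n) R, exists r1 r2,
    [/\ closed_measure c mu, (mather_action H mu <= 0)%E,
      (\int[mu]_z (v1 z.1.1 z.2)%:E = r1%:E)%E,
      (\int[mu]_z (v2 z.1.1 z.2)%:E = r2%:E)%E & s <= r1 - r2].
Proof.
move=> /nonneg_density_cone /(nonneg_functional (@codes_nonempty R n)).
move=> [L [LD LZ L_le LN]].
pose G i t := (torus_pi (code_pos t), velocity H i (code_point K t)) : torus R d * 'rV[R]_d.
have cG i : continuous (G i).
  have c1 : continuous (fun t : R => torus_pi (code_pos t : 'rV[R]_d)).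
    move=> t; apply: (@continuous_comp _ _ _ code_pos torus_pi).
      apply: (@continuous_comp _ _ _ (@code_point R d K) fst); last exact: cvg_fst.
      exact: continuous_code_point.
    exact: continuous_torus_pi.
  have c2 : continuous (fun t : R => velocity H i (code_point K t : 'rV[R]_d * 'rV[R]_d)).
    move=> t; apply: (@continuous_comp _ _ _ (@code_point R d K) (velocity H i)).
      exact: continuous_code_point.
    exact: continuous_velocity.
  by move=> t; exact: (cvg_pair (c1 t) (c2 t)).
pose mu := coded_measure cG LD LZ L_le.
have int (F : idx n -> 'rV[R]_d * 'rV[R]_d -> R) (g : borel_phase R d n -> \bar R) :
    (forall i, continuous (F i)) ->
    measurable_fun setT g -> (forall t, g (decode G t) = (piecewise K F t)%:E) ->
    mu.-integrable setT g /\ (\int[mu]_z g z = (L (piecewise K F))%:E)%E.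
  move=> cF mg gE; exact: (coded_integral cG LD LZ L_le mg gE
    (piecewise_bounded K cF) (fun e e0 => piecewise_uniform K cF e0)).
have LN0 (f : R -> R) : bounded_on (@codes R n) f -> L (fun t => - f t) = - L f.
  move=> bf; rewrite -mulN1r -LZ//; congr L.
  by apply/funext => t; rewrite mulN1r.
have C1_0 (i : idx n) : torus_C1 (fun _ : torus R d => 0 : R).
  have [+ _] := C1_lincomb 0 0 (penalty_C1 (0 : 'rV[R]_d)).1 (penalty_C1 (0 : 'rV[R]_d)).1.
  rewrite (_ : (fun x => _) = (fun _ : torus R d => 0 : R) \o torus_pi)//.
  by apply/funext => x; rewrite !mul0r addr0.
have grad0 (x : torus R d) : torus_grad (fun=> 0 : R) x = 0.
  by apply/rowP => k; rewrite !mxE; exact: derive_cst.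
have test0 i (z : 'rV[R]_d * 'rV[R]_d) : test_density H c (fun _ _ => 0) i z = 0.
  rewrite /test_density grad0 dot0r add0r /coupling big1// => j _.
  by rewrite subrr mulr0.
(* The cone contains the densities of both [phi] and [- phi], which forces equality. *)
have L_test (phi : torus R d -> idx n -> R) : 
    (forall i, torus_C1 (phi ^~ i)) -> L (piecewise K (test_density H c phi)) = 0.
  move=> phiC1; have b1 := piecewise_bounded K (continuous_test_density phiC1).
  apply/eqP; rewrite eq_le; apply/andP; split.
    rewrite -oppr_ge0 -LN0//; apply: LN.
    exists (fun x i => - 1 * phi x i + 0 * phi x i), 0, 0; split => //.
      by move=> i; have [] := C1_lincomb (- 1) 0 (phiC1 i) (phiC1 i).
    apply/funext => t; rewrite /piecewise /cone_density test_density_lincomb//; ring.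
  apply: LN; exists phi, 0, 0; split => //.
  by apply/funext => t; rewrite /piecewise /cone_density; ring.
have cA i := @continuous_action_density R d n H H_C2 i.
have L_act : L (piecewise K (action_density H)) <= 0.
  rewrite -oppr_ge0 -LN0; last exact: piecewise_bounded.
  apply: LN; exists (fun _ _ => 0), 1, 0; split => //.
  by apply/funext => t; rewrite /piecewise /cone_density test0; ring.
pose V (v : torus R d -> idx n -> R) (i : idx n) (z : 'rV[R]_d * 'rV[R]_d) : R :=
  v (torus_pi z.1) i.
have cV1 i : continuous (V v1 i) by exact: (continuous_value (@cv1 i)).
have cV2 i : continuous (V v2 i) by exact: (continuous_value (@cv2 i)).
have intV (v : torus R d -> idx n -> R) :
    (forall i, continuous (v ^~ i)) -> (forall i, continuous (V v i)) ->
    (\int[mu]_z (v z.1.1 z.2)%:E = (L (piecewise K (V v)))%:E)%E.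
  move=> cv cVv; have [] := int (V v) (fun z => (v z.1.1 z.2)%:E) cVv => //.
  apply: borel_phase_continuous.
  apply: (@continuous_phase _ _ _ (fun i y => v y.1 i)) => i y.
  by apply: (@continuous_comp _ _ _ fst (v ^~ i)); [exact: cvg_fst|exact: cv].
exists mu, (L (piecewise K (V v1))), (L (piecewise K (V v2))).
have b1 := piecewise_bounded K cV1; have b2 := piecewise_bounded K cV2.
split.
- split; first exact: radon_coded_measure.
  move=> phi phiC1 g.
  have [||] := int (test_density H c phi) g (continuous_test_density phiC1).
  + apply: borel_phase_continuous.
    apply: (@continuous_phase _ _ _ (fun i y =>
      dot y.2 (torus_grad (phi ^~ i) y.1) + coupling c phi y.1 i)).
    exact: continuous_test.
  + by [].
  + by rewrite (L_test phi phiC1).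
- have [] := int (action_density H) (fun z => lagrangian H z.1.1 z.1.2 z.2) cA.
  + exact: measurable_lagrangian.
  + by move=> t; exact: lagrangian_velocity.
  + by move=> _; rewrite /mather_action => ->; rewrite lee_fin.
- exact: intV.
- exact: intV.
- have -> : L (piecewise K (V v1)) - L (piecewise K (V v2)) =
      L (fun t => piecewise K (V v1) t - piecewise K (V v2) t).
    by rewrite (functionalB LD LZ).
  have bB : bounded_on (@codes R n) (fun t => piecewise K (V v1) t - piecewise K (V v2) t).
    rewrite (_ : (fun t => _) = (fun t => piecewise K (V v1) t + -1 * piecewise K (V v2) t)).
      by apply: bounded_onD => //; exact: bounded_onZ.
    by apply/funext => t; ring.
  have bs := bounded_on_cst (@codes R n) s.
  rewrite -subr_ge0 -[X in _ - X](functional_cst LZ L_le s) -(functionalB LD LZ)//.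
  apply: LN; exists (fun _ _ => 0), 0, 1; split => //.
  by apply/funext => t; rewrite /piecewise /cone_density /V test0; ring.
Qed.

End mather_measure_existence.

(** * Lipschitz bounds on representatives, and the conclusion *)

Lemma torus_lipschitz_lift (R : realType) (d : nat) (u : torus R d -> R) :
  torus_lipschitz u -> exists C, 0 <= C /\
    forall x y, `|u (torus_pi x) - u (torus_pi y)| <= C * enorm (x - y).
Proof.
(* The sign of [C] is not given, and bounding the infimum by the distance of two given
   representatives needs a nonnegative factor. *)
move=> [C uC]; exists `|C|; split=> // x y.
rewrite (le_trans (uC _ _))// /torus_dist.
set D := [set r | exists x' y', _].
have D_lb : lbound D 0 by move=> _ [x' [y' [_ _ ->]]]; exact: enorm_ge0.
have Dxy : D (enorm (x - y)) by exists x, y.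
have d0 : 0 <= inf D by apply: lb_le_inf => //; exists (enorm (x - y)).
have d1 : inf D <= enorm (x - y) by apply: ge_inf => //; exists 0.
rewrite (@le_trans _ _ (`|C| * inf D))//; first by rewrite ler_wpM2r ?ler_norm.
by rewrite ler_wpM2l.
Qed.


Theorem theorem1p2 (R : realType) (d n : nat) (d_gt0 : (0 < d)%N)
  (H : torus R d -> 'rV[R]_d -> idx n -> R)
  (c : idx n -> idx n -> R)
  (c_ge0 : forall i j, 0 <= c i j)
  (H_C2 : hamiltonian_C2 H)
  (A1 : forall x i,
     convex_function [set: convex_lmodType 'rV[R]_d] (fun p => H x p i))
  (A2_superlinear : unif_coercive (fun x p i => H x p i / enorm p))
  (A2_gradient : unif_coercive (fun x p i =>
     (2 * d%:R)^-1 * H x p i ^+ 2 + dot (DxH H x p i) p))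
  (A3 : exists2 C : R, 0 < C & forall x p i,
     enorm (DxH H x p i) <= C * (1 + enorm p ^+ 2))
  (A4 : forall i j, c i j = c j i)
  (v1 v2 : torus R d -> idx n -> R)
  (v1_lipschitz : forall i, torus_lipschitz (v1 ^~ i))
  (v2_lipschitz : forall i, torus_lipschitz (v2 ^~ i))
  (v1_solution : viscosity_solution H c v1)
  (v2_solution : viscosity_solution H c v2)
  (v1_le_v2_mather : forall mu : probability (borel_phase R d n) R,
     mather_measure H c mu ->
     (\int[mu]_z (v1 z.1.1 z.2)%:E <= \int[mu]_z (v2 z.1.1 z.2)%:E)%E) :
  forall x i, v1 x i <= v2 x i.
Proof.
move=> x i; rewrite leNgt; apply/negP => v21.
have [C CP] := choice (fun j => torus_lipschitz_lift (v2_lipschitz j)).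
pose K := \sum_j C j.
have C0 j : 0 <= C j by have [] := CP j.
have K0 : 0 <= K by exact: sumr_ge0.
have v2_lip j y z : `|v2 (torus_pi y) j - v2 (torus_pi z) j| <= K * enorm (y - z).
  have [_ /(_ y z)/le_trans] := CP j; apply; rewrite ler_wpM2r ?enorm_ge0//.
  by rewrite /K (bigD1 j)//= lerDl; exact: sumr_ge0.
have [v1_sub _] := v1_solution; have [_ v2_sup] := v2_solution.
pose s := (v1 x i - v2 x i) / 2.
have s0 : 0 < s by rewrite divr_gt0// subr_gt0.
have sM : s < v1 x i - v2 x i by rewrite /s; move: v21; lra.
have [mu [r1 [r2 [mu_closed mu_le0 mu1 mu2 sr]]]] :=
  near_mather_measure c_ge0 H_C2 A1 A2_superlinear K0 v1_sub v2_sup v2_lip sM.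
(* A closed measure of nonpositive action is a minimizer, since no closed measure has negative
   action. *)
have mather_mu : mather_measure H c mu.
  split=> // nu nu_closed; apply: (le_trans mu_le0).
  exact: (mather_action_ge0 c_ge0 H_C2 A1 A2_superlinear v1_sub nu_closed).
have := v1_le_v2_mather _ mather_mu.
by rewrite mu1 mu2 lee_fin; move: sr s0; lra.
Qed.
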